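(* Let $\Gamma$ be an Eulerian poset with $|\Gamma|>1$, with unique minimal element $\hat 0_\Gamma$ and unique maximal element $\hat 1_\Gamma$. Let $q\notin\{\hat 0_\Gamma,\hat 1_\Gamma\}$ be a join-admissible element of $\Gamma$. Let $Y=\Gamma_{\ge q}=\{z\in\Gamma:q\le z\}$, $X=\Gamma\smallsetminus Y$, and $\sigma:X\to Y$, $\sigma(x)=x\vee q$; write $\hat 0_Y=q$, $\hat 1_Y=\hat 1_\Gamma$. Then $$\Phi(\Gamma)=\ell^{\Phi}(X)+\frac12\left[\Phi(\overline{\partial X})\,c+\Phi(\overline{X_{\le\hat 0_Y}})\,c\,\Phi(Y)+\sum_{\hat 0_Y<y<\hat 1_Y}\left(\ell^{\Phi}(X_{\le y})\,c+\Phi(\overline{X_{<y}})\,d\right)\Phi([y,\hat 1_Y])\right],$$ where $\Phi$ denotes the $cd$-index, $\ell^{\Phi}$ the local $cd$-index, $X_{\le y}=\{x\in X:\sigma(x)\le y\}$, $X_{<y}=\{x\in X:\sigma(x)<y\}$, and $\partial X=X_{<\hat 1_Y}$.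
   Context: All posets are finite. A rank function for a nonempty poset $B$ is $\rho_B:B\to\mathbb{Z}$ with $\rho_B(z')=\rho_B(z)+1$ whenever $z'$ covers $z$; $\operatorname{rank}(B)$ is the length of the longest maximal chain ($z_0<\dots<z_s$ has length $s$). A poset $B$ with a rank function is Eulerian if it has a unique minimal element $\hat 0_B$ and a unique maximal element $\hat 1_B$ and $\sum_{z\le z''\le z'}(-1)^{\rho_B(z'')}=0$ for all $z<z'$ in $B$. $[z,z']=\{z'':z\le z''\le z'\}$. $q\in\Gamma$ is join-admissible if for every $z\in\Gamma$ the join (least upper bound) $z\vee q$ exists in $\Gamma$. $\overline{B}$ denotes the poset obtained from $B$ by adjoining a new element greater than all elements of $B$. $cd$-index: let $B$ be Eulerian of rank $n+1$, $n\ge0$, with rank function $\rho_B$ normalized by $\rho_B(\hat 0_B)=0$. For $S\subset[n]=\{1,\dots,n\}$ let $w_S=w_1\cdots w_n$ be the monomial in noncommuting variables $a,b$ with $w_i=a-b$ if $i\notin S$ and $w_i=b$ if $i\in S$; let $f_S$ be the number of maximal chains of $\{z\in B:\rho_B(z)\in S\}\cup\{\hat 0_B,\hat 1_B\}$; let $\Psi(B;a,b)=\sum_{S\subset[n]}f_Sw_S$. The $cd$-index $\Phi(B)=\Phi(B;c,d)$ is the unique polynomial in noncommuting variables $c,d$ with $\Phi(B;a+b,ab+ba)=\Psi(B;a,b)$ (it exists, by a known theorem of Fine). Near-Eulerian posets: a nonempty poset $B$ is near-Eulerian if there is an Eulerian poset $\tilde\Sigma B$ of positive rank and a maximal element $\hat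 z$ of $\tilde\Sigma B\smallsetminus\{\hat 1\}$ (where $\hat 1$ is the maximum of $\tilde\Sigma B$) such that $B=\tilde\Sigma B\smallsetminus\{\hat z,\hat 1\}$. The poset $\tilde\Sigma B$, called the semisuspension, is uniquely determined by $B$. The boundary $\partial B$ is the lower order ideal of $B$ generated by all $z\in B$ such that exactly one element of $B$ is strictly greater than $z$; equivalently $\partial B=\{z\in\tilde\Sigma B:z<\hat z\}$, and $\overline{\partial B}$ is Eulerian of positive rank. The local $cd$-index of a near-Eulerian poset is $\ell^{\Phi}(B)=\Phi(\tilde\Sigma B)-\Phi(\overline{\partial B})\,c$. In the situation of the claim it is known that $Y$ is Eulerian, $X_{\le y}$ is near-Eulerian with boundary $X_{<y}$ for each $y\neq\hat 0_Y$ in $Y$ (in particular $X=X_{\le \hat 1_Y}$ is near-Eulerian with boundary $\partial X$), and $\overline{X_{\le\hat 0_Y}}=[\hat 0_\Gamma,q]$ is Eulerian, so all terms are defined. *)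

(* Defs.v *)
From HB Require Import structures.
From mathcomp Require Import all_boot all_order all_algebra.
From mathcomp Require Import boolp classical_sets.
From mathcomp Require Import monalg.

Set Implicit Arguments.
Unset Strict Implicit.
Unset Printing Implicit Defensive.

Import Order.TTheory GRing.Theory Num.Theory.

Local Open Scope ring_scope.
Local Open Scope order_scope.

Section NoncommutativePolynomials.

(* Rational polynomials in two noncommuting variables.  The same algebra is
   used for the variables a, b and for the variables c, d: the names below are
   the two pairs of names of the two free generators. *)
Definition ncpoly := {malg rat[{fmonom bool}]}.

Definition ncvar (i : bool) : ncpoly := << fmu i >>%R.

Definition var_a : ncpoly := ncvar false.
Definition var_b : ncpoly := ncvar true.
Definition var_c : ncpoly := ncvar false.
Definition var_d : ncpoly := ncvar true.

(* p(u, v): the first generator is replaced by u, the second one by v. *)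
Definition ncsubst (p u v : ncpoly) : ncpoly :=
  mmap (fun r : rat => r%:MP%R : ncpoly)
       (fun m : {fmonom bool} => (\prod_(i <- m) (if i then v else u))%R) p.

End NoncommutativePolynomials.

Section SubPoset.
Context (d : Order.disp_t) (T : finPOrderType d).

Definition subposet (A : {set T}) : predArgType := {x : T | x \in A}.

Context (A : {set T}).
HB.instance Definition _ := SubFinite.on (subposet A).
HB.instance Definition _ := [SubChoice_isSubPOrder of subposet A by <: with d].

End SubPoset.

Section WithTop.
Context (d : Order.disp_t) (T : finPOrderType d).

Definition with_top : predArgType := option T.

HB.instance Definition _ := Finite.on with_top.

Definition with_top_le (x y : with_top) : bool :=
  match x, y with
  | _, None => true
  | None, Some _ => false
  | Some x', Some y' => x' <= y'
  end.

Fact with_top_le_refl : reflexive with_top_le.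
Proof. by case=> [x|] //=. Qed.

Fact with_top_le_anti : antisymmetric with_top_le.
Proof. by case=> [x|] [y|] //= /le_anti ->. Qed.

Fact with_top_le_trans : transitive with_top_le.
Proof. by case=> [y|] [x|] [z|] //=; apply: le_trans. Qed.

HB.instance Definition _ := Order.Le_isPOrder.Build d with_top
  with_top_le_refl with_top_le_anti with_top_le_trans.

End WithTop.

Section Posets.
Context (d : Order.disp_t) (B : finPOrderType d).
Implicit Types (x y z : B) (A C : {set B}).

Definition is_minimal z : Prop := forall x, ~~ (x < z).
Definition is_maximal z : Prop := forall x, ~~ (z < x).

Definition covers z' z : bool := (z < z') && [forall x, ~~ (z < x < z')].

Definition is_rank_function (rho : B -> int) : Prop :=
  forall z z', covers z' z -> rho z' = (rho z + 1)%R.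

Definition is_chain C : bool := [forall x in C, forall y in C, x >=< y].

Definition is_maximal_chain A C : bool :=
  maxset [pred C' : {set B} | (C' \subset A) && is_chain C'] C.

Definition poset_rank : nat :=
  (\max_(C : {set B} | is_maximal_chain [set: B] C) #|C|.-1)%N.

Definition eulerian_with (rho : B -> int) (zero one : B) : Prop :=
  [/\ is_rank_function rho,
      unique is_minimal zero,
      unique is_maximal one
    & forall z z', z < z' -> (\sum_(x | (z <= x <= z')%O) (-1 : int) ^ rho x = 0)%R].

Definition eulerian : Prop :=
  exists (rho : B -> int) (zero one : B), eulerian_with rho zero one.

Definition is_join x y j : bool :=
  [&& x <= j, y <= j & [forall u, (x <= u) && (y <= u) ==> (j <= u)]].

Definition join_admissible q : Prop := forall z, exists j, is_join z q j.

(* Only meaningful when the join exists. *)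
Definition pjoin x y : B := odflt x [pick j | is_join x y j].

Definition cinterval z z' : {set B} := [set x | z <= x <= z'].

Definition boundary : {set B} :=
  [set x | [exists z, (x <= z) && (#|[set y | z < y]| == 1%N)]].

(* The index i : 'I_n stands for the rank i.+1 in [n] = {1, ..., n}. *)
Definition flag_number (n : nat) (rho : B -> int) (zero one : B)
    (S : {set 'I_n}) : nat :=
  #|[set C : {set B} |
      is_maximal_chain
        ([set z | [exists i in S, rho z == i.+1%:Z]] :|: [set zero; one]) C]|.

Definition ab_word (n : nat) (S : {set 'I_n}) : ncpoly :=
  (\prod_(i < n) (if i \in S then var_b else var_a - var_b))%R.

Definition ab_index (n : nat) (rho : B -> int) (zero one : B) : ncpoly :=
  (\sum_(S : {set 'I_n}) (flag_number rho zero one S)%:R *: ab_word S)%R.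

Definition is_cd_index (p : ncpoly) : Prop :=
  exists (rho : B -> int) (zero one : B) (n : nat),
    [/\ eulerian_with rho zero one,
        rho zero = 0%R,
        poset_rank = n.+1
      & ncsubst p (var_a + var_b)%R (var_a * var_b + var_b * var_a)%R
        = ab_index n rho zero one].

(* "The" polynomial satisfying [is_cd_index], and 0 if there is none. *)
Definition cd_index : ncpoly :=
  xget (0%R : ncpoly) [set p : ncpoly | is_cd_index p]%classic.

End Posets.

Section NearEulerian.
Context (d : Order.disp_t) (B : finPOrderType d).

(* S is a semisuspension of B (up to isomorphism), with extra element hz:
   f identifies B with S minus hz and the maximum of S. *)
Definition is_semisuspension (d' : Order.disp_t) (S : finPOrderType d')
    (hz : S) : Prop :=
  [/\ eulerian S, (0 < poset_rank S)%N
    & exists one : S,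
      [/\ unique (@is_maximal _ S) one,
          hz != one,
          forall x : S, x != one -> ~~ (hz < x)
        & exists f : B -> S,
            {mono f : x y / x <= y} /\
            f @: [set: B] = [set: S] :\: [set hz; one]]].

Definition near_eulerian : Prop :=
  (0 < #|B|)%N /\
  exists (d' : Order.disp_t) (S : finPOrderType d') (hz : S),
    is_semisuspension hz.

Definition is_local_cd_index (p : ncpoly) : Prop :=
  (0 < #|B|)%N /\
  exists (d' : Order.disp_t) (S : finPOrderType d') (hz : S),
    is_semisuspension hz /\
    p = (cd_index S - cd_index (with_top (subposet (boundary B))) * var_c)%R.

(* "The" value at any semisuspension of B, and 0 if B is not near-Eulerian. *)
Definition local_cd_index : ncpoly :=
  xget (0%R : ncpoly) [set p : ncpoly | is_local_cd_index p]%classic.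

End NearEulerian.

Section JoinDecomposition.
Context (d : Order.disp_t) (G : finPOrderType d) (q : G).

Definition upset_of : {set G} := [set z | q <= z].

Definition outside_of : {set G} := ~: upset_of.

(* The map sigma : X -> Y is x |-> pjoin x q. *)
Definition fiber_le (y : G) : {set G} := [set x in outside_of | pjoin x q <= y].
Definition fiber_lt (y : G) : {set G} := [set x in outside_of | pjoin x q < y].

End JoinDecomposition.

(* Main.v *)
Require Import Defs.
From HB Require Import structures.
From mathcomp Require Import all_boot all_order all_algebra.
From mathcomp Require Import monalg.
From mathcomp Require boolp classical_sets.
From mathcomp Require Import zify ring.

(** Everything is computed with ab-indices.  For a ranked poset let [psi x y] be the
    ab-index of the interval from [x] to [y], a sum over its chains, and put
    [e = a - b].  Cutting the chains at their largest or smallest element gives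
    [psi = E + psi * b * E = E + E * b * psi] for the convolution over middle
    elements, where [E x y] is [e] to the power of the number of ranks strictly
    between [x] and [y] ([psi_recr], [psi_convl]).  The Euler relations add the
    recursion with [a] and [b] exchanged ([psi_swap]).  The average of the two has
    coefficients in [c = a + b] and [e^2 = c^2 - 2 d], which yields the existence
    of the cd-index by induction ([psi_cd_image]).  The substitution of [c] and [d]
    by polynomials in [a] and [b] is injective ([cd_subst_inj]), so the cd-index is
    determined by [psi] ([cd_subst_cd_index]), and it suffices to prove the
    ab-version of the identity.

    Let [X] be the complement of the up-set [Y] of [q].  For [x] in [X] let [K x]
    collect the chains that end at [x], and for [y] in [Y] let
    [G y] be the sum of [K x * E x y] over all [x <= y] in [X], and [B y * e] the
    same sum restricted to those [x] whose join with [q] is strictly below [y].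
    Both are instances of [cone].  The semisuspension of the fiber over [y] has an
    additional coatom above exactly the second kind of elements, so that its
    ab-index is [G y + B y * b], while [B y] belongs to the boundary; the local
    ab-index is therefore [G y - B y * a] ([local_cd_index_fiber]).  That the fiber
    is near-Eulerian follows from the alternating sums over the elements of [X]
    above a given [x] whose join with [q] is prescribed ([sum_join_fiber]).
    Conversely, parity of intervals recovers the order of any semisuspension from
    the fiber ([boundary_semisusp]), so its cd-index depends on nothing else
    ([psi_semisusp]).

    Cutting the chains at their first element in [Y] gives
    [psi 0 1 = G 1 + sum G y * b * psi y 1] ([psi_first_above]).  After
    multiplication by 2 the asserted identity reduces to
    [B 1 * e + sum B y * e * a * psi y 1 = sum G y * e * psi y 1].  The coefficients
    of [K x] on both sides agree by the recursion of [psi] on the interval from the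
    join of [x] and [q] to the top ([cone_exchange]). *)

Set Implicit Arguments.
Unset Strict Implicit.
Unset Printing Implicit Defensive.

Import Order.TTheory GRing.Theory Num.Theory.

Local Open Scope ring_scope.

(** * Noncommutative polynomials *)

Section MonoidAlgebra.
Context (R : comNzRingType) (K : monomType).
Implicit Types (p g : {malg R[K]}).

Lemma malg_ind (P : {malg R[K]} -> Prop) :
  P 0 -> (forall r k p, P p -> P (r *: << k >> + p)) -> forall p, P p.
Proof.
move=> P0 PD p; rewrite [p]monalgE; elim/big_rec: _ => [//|k q _ Pq].
have -> : << p@_k *g k >> = p@_k *: (<< k >> : {malg R[K]}).
  by apply/malgP => k'; rewrite mcoeffZ !mcoeffU mulr_natr.
exact: PD.
Qed.

Lemma mul_malgUU (k l : K) :
  (<< k >> : {malg R[K]}) * << l >> = << mmul k l >>.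
Proof. by rewrite malgM_def fgmulUU mulr1. Qed.

(** The coefficients commute with one another and with every monomial, so a
    scalar can cross any factor although the monomials need not commute. *)
Lemma malg_scalerAr r p g : r *: (p * g) = p * (r *: g).
Proof.
elim/malg_ind: p g => [|r' k p IHp] g; first by rewrite !mul0r scaler0.
rewrite !mulrDl scalerDr IHp; congr (_ + _).
rewrite -!scalerAl scalerA mulrC -scalerA; congr (_ *: _).
elim/malg_ind: g => [|r2 l g IHg]; first by rewrite !(scaler0, mulr0).
rewrite scalerDr !mulrDr scalerDr IHg; congr (_ + _).
have E t : << k >> * (t *: << l >>) = t *: (<< k >> * << l >>) :> {malg R[K]}.
  have -> : t *: << l >> = << t *g l >> :> {malg R[K]}.
    by apply/malgP => m; rewrite mcoeffZ !mcoeffU mulr_natr.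
  rewrite mul_malgUU malgM_def fgmulUU mul1r.
  by apply/malgP => m; rewrite mcoeffZ !mcoeffU mulr_natr.
by rewrite scalerA !E scalerA.
Qed.

End MonoidAlgebra.

Section LinearExtension.
Context (R : comNzRingType) (K L : monomType) (h : K -> {malg R[L]}).

(** The linear map that takes the values [h] on the basis of monomials. *)
Definition linear_ext (p : {malg R[K]}) : {malg R[L]} :=
  mmap (fun r : R => r%:MP%R) h p.

Fact linear_ext_is_zmod_morphism : zmod_morphism linear_ext.
Proof. by move=> p g; rewrite /linear_ext raddfB. Qed.

HB.instance Definition _ := GRing.isZmodMorphism.Build
  {malg R[K]} {malg R[L]} linear_ext linear_ext_is_zmod_morphism.

Fact linear_ext_is_scalable : scalable linear_ext.
Proof.
move=> r p; rewrite /linear_ext (mmapEw (msuppZ_le _ _)) mmapE scaler_sumr.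
by apply: eq_bigr => k _; rewrite mcoeffZ !mul_malgC scalerA.
Qed.

HB.instance Definition _ := GRing.isScalable.Build
  R {malg R[K]} {malg R[L]} *:%R linear_ext linear_ext_is_scalable.

Lemma linear_extU k : linear_ext << k >> = h k.
Proof. by rewrite /linear_ext mmapU mul1r. Qed.

Lemma linear_ext_is_monoid_morphism :
  mmorphism h -> monoid_morphism linear_ext.
Proof.
case=> hM h1; split; first by rewrite linear_extU.
move=> p g; elim/malg_ind: p => [|r k p IHp]; first by rewrite !(mul0r, raddf0).
rewrite mulrDl !raddfD /= mulrDl IHp; congr (_ + _).
rewrite -scalerAl !linearZ /= -scalerAl; congr (_ *: _).
elim/malg_ind: g {IHp} => [|r' l g IHg]; first by rewrite !(mulr0, raddf0).
rewrite mulrDr !raddfD /= mulrDr IHg; congr (_ + _).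
rewrite -malg_scalerAr !linearZ /= -malg_scalerAr; congr (_ *: _).
by rewrite mul_malgUU !linear_extU hM.
Qed.

End LinearExtension.

Section FreeAlgebra.
Context (R : comNzRingType) (I : choiceType).
Local Notation A := {malg R[{fmonom I}]}.
Implicit Types (p g : A) (s : seq I) (i j : I).

Definition letter i : A := << fmu i >>.
Definition word s : A := << (FMonom s : {fmonom I}) >>.

Lemma word_nil : word [::] = 1.
Proof. by rewrite /word -fmoneE. Qed.

Lemma word_cons i s : word (i :: s) = letter i * word s.
Proof. by rewrite mul_malgUU; congr << _ >>; apply/eqP; rewrite fmP fmM fmU. Qed.

Lemma word_ind (P : A -> Prop) :
  P 0 -> (forall r s p, P p -> P (r *: word s + p)) -> forall p, P p.
Proof.
by move=> P0 PD; apply: malg_ind => // r k p Pp; rewrite -[k]fmK; apply: PD.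
Qed.

Section Substitution.
Variable v : I -> A.

Definition letter_subst : A -> A :=
  linear_ext (fun m : {fmonom I} => \prod_(i <- m) v i).

HB.instance Definition _ := GRing.Linear.on letter_subst.

Fact letter_subst_is_monoid_morphism : monoid_morphism letter_subst.
Proof.
apply: linear_ext_is_monoid_morphism; split=> [k l|].
  by rewrite fmM big_cat.
by rewrite fm1 big_nil.
Qed.

HB.instance Definition _ :=
  GRing.isMonoidMorphism.Build A A letter_subst letter_subst_is_monoid_morphism.

Lemma letter_subst_letter i : letter_subst (letter i) = v i.
Proof. by rewrite /letter_subst linear_extU fmU big_seq1. Qed.

End Substitution.

(** Removing the first letter [i]: words that start with another letter,
    and the empty word, are sent to 0. *)
Definition strip i : A -> A :=
  linear_ext (fun m : {fmonom I} =>
    if (m : seq I) is j :: s then if i == j then word s else 0 else 0).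

HB.instance Definition _ i := GRing.Linear.on (strip i).

Lemma strip1 i : strip i 1 = 0.
Proof. rewrite -word_nil; exact: linear_extU. Qed.

Lemma stripP i r p g : strip i (r *: p + g) = r *: strip i p + strip i g.
Proof. exact: linearP. Qed.

Lemma strip_word i j s : strip i (word (j :: s)) = if i == j then word s else 0.
Proof. exact: linear_extU. Qed.

Lemma strip_letterM i j p : strip i (letter j * p) = if i == j then p else 0.
Proof.
elim/word_ind: p => [|r s p IH]; first by rewrite mulr0 raddf0 if_same.
rewrite mulrDr raddfD /= [X in _ + X]IH -malg_scalerAr linearZ /= -word_cons.
rewrite strip_word; case: (i == j); first by [].
by rewrite scaler0 addr0.
Qed.

Lemma mcoeff_word_cons i s p :
  p@_(FMonom (i :: s) : {fmonom I}) = (strip i p)@_(FMonom s : {fmonom I}).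
Proof.
elim/word_ind: p => [|r t p IH]; first by rewrite !raddf0.
rewrite stripP !mcoeffD !mcoeffZ IH; congr (_ * _ + _).
case: t => [|j t]; first by rewrite word_nil strip1 mcoeff0 mcoeff1 fmP fm1.
rewrite word_cons strip_letterM -word_cons mcoeffU1 fmP /= eqseq_cons (eq_sym j).
case: (i == j); last by rewrite mcoeff0.
by rewrite mcoeffU1 fmP.
Qed.

Lemma mcoeff1_letterM i p : (letter i * p)@_(mone : {fmonom I}) = 0.
Proof.
elim/word_ind: p => [|r s p IH]; first by rewrite mulr0 mcoeff0.
rewrite mulrDr mcoeffD [X in _ + X]IH -malg_scalerAr mcoeffZ -word_cons mcoeffU1.
by rewrite fmP fm1 mulr0 addr0.
Qed.

Lemma letter_ind (P : A -> Prop) :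
    P 0 -> P 1 -> (forall i p, P p -> P (letter i * p)) ->
    (forall r p g, P p -> P g -> P (r *: p + g)) ->
  forall p, P p.
Proof.
move=> P0 P1 PM PD; apply: word_ind => // r s p Pp; apply: (PD) Pp.
by elim: s => [|i s Ps]; rewrite ?word_nil // word_cons; apply: PM.
Qed.

(** The coefficient of a word is the constant term that is left after its
    letters have been removed one by one. *)
Lemma strip_separation (P : A -> Prop) :
    (forall p, P p -> p@_(mone : {fmonom I}) = 0) ->
    (forall i p, P p -> P (strip i p)) ->
  forall p, P p -> p = 0.
Proof.
move=> P1 Ps p Pp; apply/malgP => m; rewrite mcoeff0 -[m]fmK.
elim: {m}(m : seq I) p Pp => [|i s IH] p Pp; first by rewrite -fmoneE P1.
by rewrite mcoeff_word_cons; apply/IH/Ps.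
Qed.

End FreeAlgebra.

(** The injectivity of the substitution only uses the following features of the
    free algebra on [a] and [b]: it is generated by the two letters, and its
    elements are separated by constant terms after removal of first letters. *)
Section CdSubstitution.
Context (R : comNzRingType) (A : lalgType R) (a b : A).
Hypothesis scaleAr : forall (r : R) (p g : A), r *: (p * g) = p * (r *: g).
Hypothesis gen_ind : forall P : A -> Prop,
    P 0 -> P 1 -> (forall p, P p -> P (a * p)) -> (forall p, P p -> P (b * p)) ->
    (forall (r : R) p g, P p -> P g -> P (r *: p + g)) ->
  forall p, P p.

Variables (strip_a strip_b : {linear A -> A}) (coeff1 : {additive A -> R}).
Hypotheses (strip_a1 : strip_a 1 = 0) (strip_b1 : strip_b 1 = 0).
Hypotheses (strip_aa : forall p, strip_a (a * p) = p)
  (strip_ab : forall p, strip_a (b * p) = 0)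
  (strip_ba : forall p, strip_b (a * p) = 0)
  (strip_bb : forall p, strip_b (b * p) = p).
Hypotheses (coeff1Z : forall r p, coeff1 (r *: p) = r * coeff1 p)
  (coeff1_a : forall p, coeff1 (a * p) = 0)
  (coeff1_b : forall p, coeff1 (b * p) = 0).
Hypothesis separation : forall P : A -> Prop,
    (forall p, P p -> coeff1 p = 0) ->
    (forall p, P p -> P (strip_a p)) -> (forall p, P p -> P (strip_b p)) ->
  forall p, P p -> p = 0.

Variable phi : {lrmorphism A -> A}.
Hypotheses (phi_a : phi a = a + b) (phi_b : phi b = a * b + b * a).

(** A word [c w] becomes [a w + b w], and a word [d w] becomes
    [a (b w) + b (a w)]. *)
Lemma strip_cd_subst p :
  strip_a (phi p) = phi (strip_a p) + b * phi (strip_b p) /\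
  strip_b (phi p) = phi (strip_a p) + a * phi (strip_b p).
Proof.
elim/gen_ind: p => [||p _|p _|r p g [IHpa IHpb] [IHga IHgb]].
- by rewrite !raddf0 !mulr0 addr0.
- by rewrite rmorph1 strip_a1 strip_b1 raddf0 !mulr0 addr0.
- rewrite rmorphM /= phi_a mulrDl !raddfD /= !strip_aa strip_ab !strip_ba strip_bb.
  by rewrite raddf0 !mulr0 !addr0 add0r.
- rewrite rmorphM /= phi_b mulrDl -!mulrA !raddfD /=.
  rewrite strip_aa !strip_ab strip_ba !strip_bb.
  by rewrite raddf0 !add0r addr0.
- rewrite !linearP /= IHpa IHpb IHga IHgb !mulrDr -!scaleAr.
  by split; rewrite scalerDr addrACA.
Qed.

Lemma coeff1_cd_subst p : coeff1 (phi p) = coeff1 p.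
Proof.
elim/gen_ind: p => [||p _|p _|r p g IHp IHg].
- by rewrite !raddf0.
- by rewrite rmorph1.
- by rewrite rmorphM /= phi_a mulrDl raddfD /= coeff1_a coeff1_b addr0.
- by rewrite rmorphM /= phi_b mulrDl -!mulrA raddfD /= !coeff1_a coeff1_b addr0.
- by rewrite linearP !raddfD /= !coeff1Z IHp IHg.
Qed.

(** If [phi p = 0], comparing the first letters of the words in [a, b]
    gives [(b - a) * phi (strip_b p) = 0], so that both strippings
    of [p] are in the kernel; descending along a word kills its coefficient. *)
Lemma cd_morphism_inj : injective phi.
Proof.
suff ker0 p : phi p = 0 -> p = 0.
  move=> p g /eqP; rewrite -subr_eq0 -raddfB => /eqP /ker0 /eqP.
  by rewrite subr_eq0 => /eqP.
have ker_strip q : phi q = 0 -> phi (strip_a q) = 0 /\ phi (strip_b q) = 0.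
  move=> q0; have [Ha Hb] := strip_cd_subst q; rewrite q0 !raddf0 in Ha Hb.
  have d0 : phi (strip_b q) = 0.
    have := congr1 strip_b Hb; have := congr1 strip_b Ha.
    rewrite !raddfD /= strip_ba strip_bb !raddf0 addr0 => E1 E2.
    by rewrite -E2 add0r in E1.
  by split=> //; rewrite d0 mulr0 addr0 in Ha.
apply: (separation (P := fun q => phi q = 0)) => q q0.
- by rewrite -coeff1_cd_subst q0 raddf0.
- by have [] := ker_strip q q0.
- by have [] := ker_strip q q0.
Qed.

End CdSubstitution.

Definition cd_letter (i : bool) : ncpoly :=
  if i then var_a * var_b + var_b * var_a else var_a + var_b.

Definition cd_subst : ncpoly -> ncpoly := letter_subst cd_letter.

HB.instance Definition _ := GRing.LRMorphism.on cd_subst.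

Lemma ncsubst_cd p :
  ncsubst p (var_a + var_b) (var_a * var_b + var_b * var_a) = cd_subst p.
Proof. by []. Qed.

Lemma cd_subst_c : cd_subst var_c = var_a + var_b.
Proof. exact: (letter_subst_letter cd_letter false). Qed.

Lemma cd_subst_d : cd_subst var_d = var_a * var_b + var_b * var_a.
Proof. exact: (letter_subst_letter cd_letter true). Qed.

Lemma cd_subst_inj : injective cd_subst.
Proof.
apply: (@cd_morphism_inj rat ncpoly var_a var_b (@malg_scalerAr _ _) _
  (@strip rat bool false) (@strip rat bool true) (@mcoeff _ _ mone)).
- move=> P P0 P1 Pa Pb PD.
  by refine (@letter_ind rat bool P P0 P1 _ PD); case; [exact: Pb | exact: Pa].
- exact: strip1.
- exact: strip1.
- exact: (@strip_letterM rat bool false false).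
- exact: (@strip_letterM rat bool false true).
- exact: (@strip_letterM rat bool true false).
- exact: (@strip_letterM rat bool true true).
- move=> r p; exact: mcoeffZ.
- exact: mcoeff1_letterM.
- exact: mcoeff1_letterM.
- move=> P P1 Pa Pb.
  by refine (@strip_separation rat bool P P1 _); case; [exact: Pb | exact: Pa].
- exact: cd_subst_c.
- exact: cd_subst_d.
Qed.

Local Open Scope order_scope.

(** * Ranked posets and chain sums *)

Section Ranked.
Context (d : Order.disp_t) (T : finPOrderType d).
Implicit Types (x y z w : T) (C : {set T}).

Definition ointerval x y : {set T} := [set z | x < z < y].

(** Refining an inequality until only covering relations are left. *)
Lemma interval_ind (P : T -> T -> Prop) :
    (forall x y, covers y x -> P x y) ->
    (forall x y z, x < z -> z < y -> P x z -> P z y -> P x y) ->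
  forall x y, x < y -> P x y.
Proof.
move=> Pcov Ptr x y; move: {2}_.+1 (ltnSn #|ointerval x y|) => n.
elim: n x y => // n IH x y lt_n xy.
have [/forallP H|] := boolP [forall z, ~~ (x < z < y)].
  by apply: Pcov; rewrite /covers xy; apply/forallP.
rewrite negb_forall => /existsP[z]; rewrite negbK => /andP[xz zy].
have sub u v : x <= u -> v <= y -> z \notin ointerval u v ->
    (#|ointerval u v| < n)%N.
  move=> xu vy zuv; rewrite -ltnS; apply: leq_trans lt_n; rewrite ltnS.
  apply: proper_card; apply/properP; split.
    apply/subsetP => w; rewrite !inE => /andP[uw wv].
    by rewrite (le_lt_trans xu uw) (lt_le_trans wv vy).
  by exists z; rewrite // inE xz.
apply: (Ptr _ _ z) => //; apply: IH => //; apply: sub => //.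
- exact: ltW.
- by rewrite inE ltxx andbF.
- exact: ltW.
- by rewrite inE ltxx.
Qed.

Lemma covers_lt x y : covers y x -> x < y.
Proof. by case/andP. Qed.

Section RankFunction.
Variables (rho : T -> int) (rkP : is_rank_function rho).

Lemma rank_lt x y : x < y -> rho x < rho y.
Proof.
move: x y; apply: interval_ind => [x y /rkP ->|x y z _ _]; first by lia.
exact: lt_trans.
Qed.

Lemma rank_le x y : x <= y -> rho x <= rho y.
Proof. by rewrite le_eqVlt => /predU1P[->//|/rank_lt/ltW]. Qed.

Lemma rank_inj_comp x y : x >=< y -> rho x = rho y -> x = y.
Proof.
move=> cxy E; case: (comparable_ltgtP cxy) => // /rank_lt; rewrite E ltxx //.
Qed.

(** Every rank strictly between those of [x < y] is attained between them. *)
Lemma rank_between x y (i : int) : x < y -> rho x < i < rho y ->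
  exists z, [/\ x < z, z < y & rho z = i].
Proof.
move=> xy; move: x y xy i; apply: interval_ind => [x y /rkP ->|x y z xz zy IHx IHy] i.
  by lia.
case/andP => xi iy; case: (ltgtP (rho z) i) => [zi|iz|<-].
- case: (IHy i); first by rewrite zi.
  by move=> w [zw wy E]; exists w; split => //; apply: lt_trans zw.
- case: (IHx i); first by rewrite iz xi.
  by move=> w [xw wz E]; exists w; split => //; apply: lt_trans zy.
- by exists z.
Qed.

End RankFunction.

Lemma rank_functions_eq (r1 r2 : T -> int) (x y : T) :
    is_rank_function r1 -> is_rank_function r2 ->
    x <= y -> r1 x = r2 x -> r1 y = r2 y.
Proof.
move=> rk1 rk2; rewrite le_eqVlt => /predU1P[->//|xy] E.
suff : r1 y - r1 x = r2 y - r2 x by lia.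
move: x y xy {E}; apply: interval_ind => [x y c|x y z _ _]; last by lia.
by rewrite (rk1 _ _ c) (rk2 _ _ c); lia.
Qed.

End Ranked.

Section Psi.
Context (R : nzRingType) (a b : R).
Let e := a - b.

Section Def.
Context (d : Order.disp_t) (T : finPOrderType d) (rho : T -> int).
Implicit Types (x y z w : T) (C : {set T}).

(** The number of ranks strictly between those of [x] and [y], for [x < y]. *)
Definition gap x y : nat := `|rho y - rho x|%N.-1.

(** The ab-index of the interval from [x] to [y], written as a sum over the chains
    [C] of the open interval: a rank contributes [b] if [C] meets it, and [a - b]
    otherwise. *)
Definition psi x y : R :=
  \sum_(C : {set T} | is_chain C && (C \subset ointerval x y))
    \prod_(i < gap x y)
      (if [exists z in C, rho z == rho x + i.+1%:Z] then b else e).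

(** The product of the incidence algebra, restricted to open intervals. *)
Definition conv (F H : T -> T -> R) x y : R :=
  \sum_(z | x < z < y) F x z * H z y.

Lemma convA F1 F2 F3 x y : conv F1 (conv F2 F3) x y = conv (conv F1 F2) F3 x y.
Proof.
rewrite /conv; under eq_bigr do rewrite mulr_sumr.
under [RHS]eq_bigr do rewrite mulr_suml.
rewrite (exchange_big_dep (fun z => x < z < y)) /=.
  apply: eq_bigr => z /andP[xz zy]; apply: eq_big => [w|w _]; last exact: mulrA.
  case: (boolP (x < w)) => //= xw; case: (boolP (w < z)) => [wz|]; last by rewrite andbF.
  by rewrite (lt_trans wz zy) zy.
by move=> z w /andP[xz zy] /andP[zw wy]; rewrite wy (lt_trans xz zw).
Qed.

End Def.

Section Recursion.
Context (d : Order.disp_t) (T : finPOrderType d) (rho : T -> int).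
Hypothesis rkP : is_rank_function rho.
Implicit Types (x y z w : T) (C : {set T}).

Local Notation gap := (gap rho).
Local Notation psi := (psi rho).

Lemma rank_gap x y : x < y -> rho y = rho x + (gap x y).+1%:Z.
Proof. by move=> /(rank_lt rkP); rewrite /gap; lia. Qed.

Lemma gapD x z y : x < z -> z < y -> gap x y = (gap x z + (gap z y).+1)%N.
Proof.
move=> xz zy; have := rank_gap xz; have := rank_gap zy.
by have := rank_gap (lt_trans xz zy); lia.
Qed.

Lemma is_chainP C :
  reflect {in C &, forall x y, x >=< y} (is_chain C).
Proof.
apply: (iffP forall_inP) => [H x y xC yC|H x xC].
  by move/forall_inP: (H x xC); apply.
by apply/forall_inP => y yC; apply: H.
Qed.

Lemma chain_top C x y z :
    z \in C -> {in C, forall w, w <= z} ->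
    is_chain C && (C \subset ointerval x y) =
    [&& is_chain (C :\ z), C :\ z \subset ointerval x z & x < z < y].
Proof.
move=> zC zmax; apply/idP/idP.
  case/andP => /is_chainP ch /subsetP sub; apply/and3P; split.
  - apply/is_chainP => u v; rewrite !inE => /andP[_ uC] /andP[_ vC]; exact: ch.
  - apply/subsetP => w; rewrite !inE => /andP[wz wC].
    have := sub w wC; rewrite inE => /andP[-> _] /=.
    by rewrite lt_neqAle wz zmax.
  - by have := sub z zC; rewrite inE.
case/and3P => /is_chainP ch /subsetP sub /andP[xz zy]; apply/andP; split.
  apply/is_chainP => u v uC vC.
  have [->|uz] := eqVneq u z; first by rewrite comparable_sym; apply/le_comparable/zmax.
  have [->|vz] := eqVneq v z; first exact/le_comparable/zmax.
  by apply: ch; rewrite !inE ?uz ?vz.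
apply/subsetP => w wC; have [->|wz] := eqVneq w z; first by rewrite inE xz.
have := sub w; rewrite !inE wz wC => /(_ isT)/andP[-> wz'] /=.
exact: lt_trans zy.
Qed.

Lemma chain_has_top C : is_chain C -> C != set0 ->
  exists2 z, z \in C & {in C, forall w, w <= z}.
Proof.
move=> /is_chainP ch /set0Pn[z0 z0C].
case: (@Order.TotalTheory.arg_maxP _ _ _ z0 (mem C) rho z0C) => z zC zmax.
exists z => // w wC; have := ch w z wC zC.
rewrite /Order.comparable => /orP[//|]; rewrite le_eqVlt => /predU1P[->//|zw].
by have := zmax w wC; rewrite /= (leNgt (rho w)) (rank_lt rkP zw).
Qed.

Lemma prod_top C x y z : x < z -> z < y -> C \subset ointerval x z ->
  \prod_(i < gap x y)
    (if [exists w in z |: C, rho w == rho x + i.+1%:Z] then b else e) =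
  \prod_(i < gap x z)
    (if [exists w in C, rho w == rho x + i.+1%:Z] then b else e) * b
    * e ^+ gap z y.
Proof.
move=> xz zy /subsetP sub.
have Ez := rank_gap xz.
rewrite (gapD xz zy) big_split_ord /= big_ord_recl mulrA; congr (_ * _ * _).
- apply: eq_bigr => i _; congr (if _ then _ else _).
  apply/exists_inP/exists_inP => [[w]|[w wC E]]; last first.
    by exists w => //; rewrite inE wC orbT.
  rewrite !inE => /predU1P[->|wC] E; last by exists w.
  by have := ltn_ord i; move/eqP: E; rewrite Ez; lia.
- case: ifPn => // /exists_inPn /(_ z); rewrite !inE eqxx => /(_ isT).
  by rewrite Ez /= addn0 eqxx.
- rewrite -[in RHS](card_ord (gap z y)) -prodr_const; apply: eq_bigr => i _.
  case: ifP => // /exists_inP[w]; rewrite !inE => /predU1P[->|wC] /eqP E.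
    by move: E; rewrite Ez /= /bump; lia.
  have := sub w wC; rewrite inE => /andP[_ /(rank_lt rkP)].
  by rewrite E Ez /= /bump; lia.
Qed.

(** Sorting the chains by their largest element. *)
Lemma psi_recr x y :
  x < y -> psi x y = e ^+ gap x y + \sum_(z | x < z < y) psi x z * b * e ^+ gap z y.
Proof.
move=> xy; rewrite /psi (bigD1 set0) /=; last first.
  by rewrite sub0set andbT; apply/is_chainP => u v; rewrite inE.
congr (_ + _).
  rewrite -[in RHS](card_ord (gap x y)) -prodr_const; apply: eq_bigr => i _.
  by case: ifP => // /exists_inP[w]; rewrite inE.
pose top z C := (z \in C) && [forall w in C, w <= z].
have topP z C : reflect (z \in C /\ {in C, forall w, w <= z}) (top z C).
  apply: (iffP andP) => -[zC H]; split => //; first exact/forall_inP.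
  exact/forall_inP.
under eq_bigl do rewrite -andbA.
transitivity (\sum_(C : {set T} | [&& is_chain C, C \subset ointerval x y & C != set0])
  \sum_(z | top z C)
    \prod_(i < gap x y)
      (if [exists z in C, rho z == rho x + i.+1%:Z] then b else e)).
  apply: eq_bigr => C /and3P[ch sub C0].
  have [z zC zmax] := chain_has_top ch C0.
  rewrite (big_pred1 z) // => w; apply/topP/eqP => [[wC wmax]|->//].
  by apply/le_anti; rewrite wmax // zmax.
rewrite (exchange_big_dep (fun z => x < z < y)) /=; last first.
  by move=> C z /and3P[_ /subsetP sub _] /topP[/sub]; rewrite inE.
apply: eq_bigr => z /andP[xz zy].
rewrite (reindex_onto (fun C => z |: C) (fun C => C :\ z)) /=; last first.
  by move=> C /andP[_ /topP[zC _]]; rewrite setD1K.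
rewrite -mulrA mulr_suml; apply: eq_big => [C|C /andP[/andP[/and3P[ch sub _] tz] /eqP E]].
  apply/idP/idP.
    case/andP => /andP[/and3P[ch sub _] /topP[zC zmax]] /eqP E.
    have := chain_top x y zC zmax; rewrite ch sub /= E => /esym/and3P[-> -> _] //.
  case/andP => ch sub.
  have zC : z \notin C.
    by apply/negP => /(subsetP sub); rewrite inE ltxx andbF.
  have tz : top z (z |: C).
    apply/topP; split; first by rewrite !inE eqxx.
    move=> w; rewrite !inE => /predU1P[->//|/(subsetP sub)].
    by rewrite inE => /andP[_ /ltW].
  rewrite tz setU1K // eqxx !andbT andbA.
  have [zC' zmax] := topP _ _ tz.
  rewrite (chain_top x y zC' zmax) setU1K // ch sub xz zy /=.
  by apply/set0Pn; exists z.
rewrite mulrA; apply: prod_top => //.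
have [zC zmax] := topP _ _ tz.
have := chain_top x y zC zmax; rewrite ch sub /= E => /esym/and3P[_ -> _] //.
Qed.

Definition epow (x y : T) : R := e ^+ gap x y.

Lemma psi_convr x y : x < y ->
  psi x y = epow x y + conv psi (fun u v => b * epow u v) x y.
Proof.
by move=> xy; rewrite psi_recr //; congr (_ + _); apply: eq_bigr => z _; rewrite mulrA.
Qed.

(** Iterating the recursion by the largest element writes [psi] as the sum of all
    products [epow * b * epow * ... * b * epow], which has the same shape when it
    is read from the left. *)
Lemma psi_convl x y : x < y ->
  psi x y = epow x y + conv (fun u v => epow u v * b) psi x y.
Proof.
move: x y; pose Pred x y := psi x y = epow x y + conv (fun u v => epow u v * b) psi x y.
suff H n x y : (#|ointerval x y| < n)%N -> x < y -> Pred x y.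
  by move=> x y; apply: (H _.+1).
elim: n x y => // n IH x y lt_n xy.
have step z : x < z < y -> Pred x z.
  case/andP => xz zy; apply: (IH _ _ _ xz); rewrite -ltnS; apply: leq_trans lt_n.
  rewrite ltnS; apply: proper_card; apply/properP; split.
    apply/subsetP => w; rewrite !inE => /andP[-> wz] /=.
    exact: lt_trans zy.
  by exists z; [rewrite inE xz | rewrite inE ltxx andbF].
rewrite /Pred psi_convr //; congr (_ + _).
transitivity (conv epow (fun u v => b * epow u v) x y +
  conv (conv (fun u v => epow u v * b) psi) (fun u v => b * epow u v) x y).
  rewrite /conv -big_split; apply: eq_bigr => z xzy.
  by rewrite (step z xzy) mulrDl.
rewrite -convA /conv -big_split; apply: eq_bigr => z /andP[xz zy] /=.
by rewrite psi_convr // mulrA mulrDr.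
Qed.

End Recursion.
End Psi.

(** * Euler relations *)

Section EulerSums.
Context (R : nzRingType) (a b : R).
Let e := a - b.
Context (d : Order.disp_t) (T : finPOrderType d) (rho : T -> int).
Hypothesis rkP : is_rank_function rho.
Hypothesis euler : forall z z' : T,
  z < z' -> \sum_(x | z <= x <= z') (-1 : int) ^ rho x = 0.
Implicit Types (x y z w : T) (C : {set T}).

Local Notation gap := (gap rho).
Local Notation psi := (psi a b rho).
Local Notation epow := (epow a b rho).

Lemma sign_rank x y : x < y -> (-1 : int) ^ rho y = (-1) ^ rho x * (-1) ^+ (gap x y).+1.
Proof.
by move=> xy; rewrite (rank_gap rkP xy) exprzDr ?unitrN1.
Qed.

Lemma sign_sqr (n : int) : (-1 : int) ^ n * (-1) ^ n = 1.
Proof. by rewrite -exprzMl ?unitrN1 // mulrNN mulr1 exp1rz. Qed.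

Lemma euler_open x y : x < y ->
  \sum_(z | x < z < y) (-1) ^+ gap x z = 1 - (-1) ^+ gap x y :> R.
Proof.
move=> xy.
suff E : \sum_(z | x < z < y) (-1) ^+ gap x z = 1 - (-1) ^+ gap x y :> int.
  move/(congr1 (fun i : int => i%:~R : R)): E.
  rewrite rmorph_sum rmorphB rmorphXn /= rmorphN1.
  by under eq_bigr do rewrite rmorphXn /= rmorphN1.
have := euler xy; rewrite (bigD1 x) ?lexx ?ltW //= (bigD1 y) /=; last first.
  by rewrite lexx ltW // gt_eqF.
rewrite (eq_bigl (fun z => x < z < y)); last first.
  move=> z; rewrite !lt_neqAle (eq_sym x) -!andbA.
  by case: (z == x); rewrite /= ?andbF //; case: (z == y); rewrite /= ?andbF ?andbT.
rewrite (sign_rank xy) (eq_bigr (fun z => (-1) ^ rho x * - (-1) ^+ gap x z)); last first.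
  by move=> z /andP[xz _]; rewrite (sign_rank xz) exprS mulN1r.
rewrite -mulr_sumr sumrN => H.
have : (-1 : int) ^ rho x * ((-1) ^ rho x + ((-1) ^ rho x * (-1) ^+ (gap x y).+1 +
   (-1) ^ rho x * - (\sum_(z | x < z < y) (-1) ^+ gap x z))) = 0.
  by rewrite H mulr0.
rewrite !mulrDr !mulrA !sign_sqr !mul1r exprS.
by move: (\sum_(z | _) _) ((-1) ^+ gap x y) => s t; lia.
Qed.

(** What [epow] becomes when [a] and [b] are exchanged. *)
Definition epowN x y : R := (- e) ^+ gap x y.

(** The powers of [e] multiply to the same power for every middle element, so that
    only the alternating sum of the Euler relation remains. *)
Lemma conv_epowN x y : x < y ->
  conv epowN (fun u v => e * epow u v) x y = epow x y - epowN x y.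
Proof.
move=> xy; rewrite /conv (eq_bigr (fun z => (-1) ^+ gap x z * e ^+ gap x y)).
  by rewrite -mulr_suml euler_open // mulrBl mul1r /epowN (exprNn e).
move=> z /andP[xz zy]; rewrite /epowN (exprNn e) -mulrA /epow -/e -exprS -exprD.
by rewrite -(gapD rkP).
Qed.

(** The Euler relations make [psi] invariant under the exchange of [a] and [b]. *)
Lemma psi_swap x y : x < y ->
  psi x y = epowN x y + conv (fun u v => epowN u v * a) psi x y.
Proof.
move=> xy.
have Ea : conv (fun u v => epowN u v * a) psi x y =
    conv epowN (fun u v => e * psi u v) x y + conv (fun u v => epowN u v * b) psi x y.
  rewrite /conv -big_split; apply: eq_bigr => z _ /=.
  by rewrite -!mulrA -mulrDr -mulrDl subrK.
have Ee : conv epowN (fun u v => e * psi u v) x y =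
    conv epowN (fun u v => e * epow u v) x y +
    conv (conv epowN (fun u v => e * epow u v * b)) psi x y.
  rewrite -convA /conv -big_split; apply: eq_bigr => z /andP[xz zy] /=.
  rewrite -mulrDr; congr (_ * _).
  rewrite (psi_convl a b rkP zy) mulrDr; congr (_ + _).
  by rewrite /conv mulr_sumr; apply: eq_bigr => w _; rewrite !mulrA.
have Eb : conv (conv epowN (fun u v => e * epow u v * b)) psi x y =
    conv (fun u v => epow u v * b) psi x y - conv (fun u v => epowN u v * b) psi x y.
  rewrite /conv -sumrB; apply: eq_bigr => z /andP[xz zy].
  rewrite -mulrBl -mulrBl -conv_epowN // /conv [in RHS]mulr_suml.
  by congr (_ * _); apply: eq_bigr => w _; rewrite !mulrA.
rewrite Ea Ee Eb conv_epowN // -(addrA (_ - _)) subrK addrA.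
by rewrite [_ + (_ - _)]addrC subrK -psi_convl.
Qed.

End EulerSums.

Section CdExists.
Context (S R : lalgType rat) (phi : {lrmorphism S -> R}) (c' d' : S) (a b : R).
Hypotheses (phi_c : phi c' = a + b) (phi_d : phi d' = a * b + b * a).
Let e := a - b.

Let im (p : R) := exists g, phi g = p.

Let imD p g : im p -> im g -> im (p + g).
Proof. by case=> p' <- [g' <-]; exists (p' + g'); rewrite raddfD. Qed.

Let imM p g : im p -> im g -> im (p * g).
Proof. by case=> p' <- [g' <-]; exists (p' * g'); rewrite rmorphM. Qed.

Let imN p : im p -> im (- p).
Proof. by case=> p' <-; exists (- p'); rewrite raddfN. Qed.

Let im1 : im 1.
Proof. by exists 1; rewrite rmorph1. Qed.

Let im0 : im 0.
Proof. by exists 0; rewrite raddf0. Qed.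

Let im_c : im (a + b).
Proof. by exists c'. Qed.

(** [(a - b)^2 = c^2 - 2 d]. *)
Let im_e2 k : im (e ^+ k.*2).
Proof.
elim: k => [|k IH]; first exact: im1.
rewrite doubleS !exprS mulrA; apply: imM IH.
exists (c' * c' - (d' + d')).
rewrite raddfB raddfD /= rmorphM /= phi_c phi_d /e.
rewrite !mulrDl !mulrDr !mulNr !mulrN opprK.
apply/eqP; rewrite subr_eq [eqbRHS](AC ((2*2)*(2*2)) (((1*5)*(6*4))*((2*7)*(3*8)))) /=.
by rewrite !addNr !addr0.
Qed.

Context (d : Order.disp_t) (T : finPOrderType d) (rho : T -> int).
Hypothesis rkP : is_rank_function rho.
Hypothesis euler : forall z z' : T,
  z < z' -> \sum_(x | z <= x <= z') (-1 : int) ^ rho x = 0.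

Local Notation gap := (gap rho).
Local Notation psi := (psi a b rho).
Local Notation epow := (epow a b rho).
Local Notation epowN := (epowN a b rho).

(** Averaging the two recursions of [psi], exchanged by the symmetry of [a] and
    [b], leaves only coefficients that are polynomials in [c] and
    [(a - b)^2 = c^2 - 2 d]. *)
Lemma psi_cd_image x y : x < y -> im (psi x y).
Proof.
move: {2}_.+1 (ltnSn (gap x y)) => n; elim: n x y => // n IH x y lt_n xy.
have half p : im (p + p) -> im p.
  case=> g gE; exists (2%:R^-1 *: g); rewrite linearZ /= gE -mulr2n -scaler_nat.
  by rewrite scalerA mulVf ?scale1r // pnatr_eq0.
have im_eN k : im (e ^+ k + (- e) ^+ k).
  rewrite (exprNn e) -signr_odd; case/boolP: (odd k) => ok.
    by rewrite expr1 mulN1r addrN; apply: im0.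
  rewrite expr0 mul1r; apply: imD; rewrite -[k]odd_double_half (negPf ok) add0n;
    exact: im_e2.
apply: half; rewrite {1}(psi_convl a b rkP xy) (psi_swap a b rkP euler xy) addrACA.
apply: imD; first exact: im_eN.
rewrite /conv -big_split /=.
elim/big_ind: _ => [|p g|z /andP[xz zy]]; [exact: im0|exact: imD|].
rewrite -mulrDl; apply: imM; last first.
  apply: (IH _ _ _ zy); rewrite -ltnS (leq_trans _ lt_n) // ltnS.
  by rewrite (gapD rkP xz zy) addnS ltnS leq_addl.
(* The coefficient is [e ^+ g * b + (- e) ^+ g * a] with [g = gap x z]: it is
   [e ^+ g * c] for even [g] and [- e ^+ g.+1] for odd [g]. *)
rewrite /epow /epowN -/e (exprNn e) -signr_odd -{1 3}[gap x z]odd_double_half.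
case: (odd _); last first.
  by rewrite expr0 mul1r add0n -mulrDr [b + a]addrC; apply: imM im_c; apply: im_e2.
rewrite expr1 mulN1r mulNr -mulrBr -opprB mulrN add1n -/e -exprSr -doubleS.
by apply: imN; apply: im_e2.
Qed.

End CdExists.

(** * Flag numbers *)

Section Extrema.
Context (d : Order.disp_t) (T : finPOrderType d).
Implicit Types (x y z w : T) (C A : {set T}).

Lemma unique_minimal_le zero : unique (@is_minimal d T) zero -> forall x, zero <= x.
Proof.
case=> _ zuniq x; move: {2}_.+1 (ltnSn #|[set y | y < x]|) => n.
elim: n x => // n IH x lt_n; have [/forallP xmin|] := boolP [forall y, ~~ (y < x)].
  by rewrite (zuniq x).
rewrite negb_forall => /existsP[y]; rewrite negbK => yx.
apply: le_trans (ltW yx); apply: IH; rewrite -ltnS; apply: leq_trans lt_n.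
rewrite ltnS; apply: proper_card; apply/properP; split.
  by apply/subsetP => w; rewrite !inE => /lt_trans; apply.
by exists y; [rewrite inE | rewrite inE ltxx].
Qed.

Lemma unique_maximal_le one : unique (@is_maximal d T) one -> forall x, x <= one.
Proof.
case=> _ ouniq x; move: {2}_.+1 (ltnSn #|[set y | x < y]|) => n.
elim: n x => // n IH x lt_n; have [/forallP xmax|] := boolP [forall y, ~~ (x < y)].
  by rewrite (ouniq x).
rewrite negb_forall => /existsP[y]; rewrite negbK => xy.
apply: le_trans (ltW xy) _; apply: IH; rewrite -ltnS; apply: leq_trans lt_n.
rewrite ltnS; apply: proper_card; apply/properP; split.
  by apply/subsetP => w; rewrite !inE; apply: lt_trans.
by exists y; [rewrite inE | rewrite inE ltxx].
Qed.

Lemma le_unique_minimal zero : (forall x, zero <= x) -> unique (@is_minimal d T) zero.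
Proof.
move=> zle; split=> [x|x xmin]; first by rewrite le_gtF.
by have := zle x; rewrite le_eqVlt => /predU1P[//|]; rewrite (negPf (xmin zero)).
Qed.

Lemma le_unique_maximal one : (forall x, x <= one) -> unique (@is_maximal d T) one.
Proof.
move=> leo; split=> [x|x xmax]; first by rewrite le_gtF.
by have := leo x; rewrite le_eqVlt => /predU1P[//|]; rewrite (negPf (xmax one)).
Qed.

Lemma maximal_chainP A C :
  reflect [/\ C \subset A, is_chain C &
             forall z, z \in A -> {in C, forall w, z >=< w} -> z \in C]
          (is_maximal_chain A C).
Proof.
apply: (iffP maxsetP) => /= [[/andP[CA chC] Cmax]|[CA chC Cmax]].
  split=> // z zA zC; have := subsetUr [set z] C => /(Cmax (z |: C)) <-.
    by rewrite !inE eqxx.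
  rewrite subUset sub1set zA CA /=; apply/is_chainP => u v.
  rewrite !inE => /predU1P[->|uC] /predU1P[->|vC].
  - exact: comparablexx.
  - exact: zC.
  - by rewrite comparable_sym; apply: zC.
  - exact: (is_chainP _ chC).
split=> [|D /andP[DA /is_chainP chD] CD]; first by rewrite CA.
apply/eqP; rewrite eqEsubset CD andbT; apply/subsetP => z zD.
apply: Cmax; first exact: (subsetP DA).
by move=> w wC; apply: chD => //; apply: (subsetP CD).
Qed.

End Extrema.

Section RankSelection.
Context (d : Order.disp_t) (T : finPOrderType d) (rho : T -> int).
Hypothesis rkP : is_rank_function rho.
Variables (zero one : T).
Hypotheses (zero_le : forall x, zero <= x) (le_one : forall x, x <= one).
Implicit Types (x y z w : T) (C A : {set T}).

Lemma comparable_rank_le x y : x >=< y -> rho x <= rho y -> x <= y.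
Proof.
rewrite /Order.comparable => /orP[//|]; rewrite le_eqVlt => /predU1P[->//|/(rank_lt rkP)].
by move=> /lt_geF ->.
Qed.

(** Otherwise the chain could be enlarged by an element of rank [i] between two
    of its consecutive members. *)
Lemma maximal_chain_rank A C (i : int) :
    zero \in A -> one \in A -> (forall z, rho z = i -> z \in A) ->
    is_maximal_chain A C -> rho zero <= i <= rho one ->
  exists2 z, z \in C & rho z = i.
Proof.
move=> zA oA iA /maximal_chainP[CA /is_chainP chC Cmax] /andP[zi io].
have zC : zero \in C by apply: Cmax => // w _; apply/le_comparable.
have oC : one \in C by apply: Cmax => // w _; rewrite comparable_sym; apply/le_comparable.
have [/exists_inP[z zC' /eqP]|none] := boolP [exists z in C, rho z == i].
  by exists z.
move/exists_inPn: none => none.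
have zi' : rho zero < i by rewrite lt_neqAle zi none.
have io' : i < rho one by rewrite lt_neqAle io eq_sym none.
have Px : (zero \in C) && (rho zero < i) by rewrite zC.
have Py : (one \in C) && (i < rho one) by rewrite oC.
have [x /andP[xC xi] xmax] := @Order.TotalTheory.arg_maxP _ _ _ zero
  (fun x => (x \in C) && (rho x < i)) rho Px.
have [y /andP[yC iy] ymin] := @Order.TotalTheory.arg_minP _ _ _ one
  (fun x => (x \in C) && (i < rho x)) rho Py.
have xy : x < y.
  have rxy : rho x < rho y by apply: lt_trans iy.
  rewrite lt_neqAle comparable_rank_le ?chC ?ltW // andbT.
  by apply: contraTneq rxy => ->; rewrite ltxx.
have [|z [xz zy rz]] := rank_between rkP (i := i) xy; first by rewrite xi.
exists z => //; apply: Cmax; first exact: iA.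
move=> w wC; case: (ltgtP (rho w) i) => [wi|iw|wi].
- rewrite comparable_sym; apply/le_comparable/(le_trans _ (ltW xz)).
  by apply: comparable_rank_le; [exact: chC | apply: xmax; rewrite wC].
- apply/le_comparable/(le_trans (ltW zy)).
  by apply: comparable_rank_le; [exact: chC | apply: ymin; rewrite wC].
- by have := none w wC; rewrite wi eqxx.
Qed.

Hypothesis rho0 : rho zero = 0.

Lemma rank_ge0 x : 0 <= rho x.
Proof. by rewrite -rho0; apply: rank_le. Qed.

(** On a maximal chain the rank function is a bijection onto the ranks from 0 to
    the rank of the top. *)
Lemma poset_rankE : poset_rank T = `|rho one|%N.
Proof.
have sizeC C : is_maximal_chain [set: T] C -> #|C|.-1 = `|rho one|%N.
  move=> maxC; case/maximal_chainP: (maxC) => _ /is_chainP chC _.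
  pose f z : 'I_(`|rho one|%N.+1) := inord `|rho z|%N.
  have fE z : f z = `|rho z|%N :> nat.
    rewrite inordK // ltnS; have := rank_le rkP (le_one z); have := rank_ge0 z.
    by have := rank_ge0 one; lia.
  rewrite -(@card_in_imset _ _ f C); last first.
    move=> u v uC vC /(congr1 val); rewrite /= !fE => E.
    apply: (rank_inj_comp rkP); first exact: chC.
    by have := rank_ge0 u; have := rank_ge0 v; lia.
  suff -> : f @: C = [set: 'I_(`|rho one|%N.+1)] by rewrite cardsT card_ord.
  apply/setP => i; rewrite inE; apply/imsetP.
  have [||||z zC rz] := maximal_chain_rank (i := i%:Z) _ _ _ maxC; rewrite ?inE //.
    have := ltn_ord i; rewrite rho0; have := rank_ge0 one; lia.
  by exists z => //; apply/val_inj; rewrite /= fE rz.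
apply/eqP; rewrite eqn_leq; apply/andP; split.
  by apply/bigmax_leqP => C /sizeC ->.
have [|C maxC _] := @maxset_exists _
  [pred C : {set T} | (C \subset [set: T]) && is_chain C] set0.
  by rewrite /= sub0set; apply/is_chainP => x y; rewrite inE.
rewrite -(sizeC C maxC).
exact: (@leq_bigmax_cond _ (is_maximal_chain [set: T])
  (fun C : {set T} => #|C|.-1) C maxC).
Qed.

Section Flags.
Variable n : nat.
Hypothesis rho1 : rho one = n.+1%:Z.

Let ranks C : {set 'I_n} := [set i : 'I_n | [exists z in C, rho z == i.+1%:Z]].

Let hull C := C :|: [set zero; one].

Let selected (S : {set 'I_n}) :=
  [set z | [exists i in S, rho z == i.+1%:Z]] :|: [set zero; one].

Lemma ointerval01 z : (z \in ointerval zero one) = (z != zero) && (z != one).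
Proof. by rewrite inE !lt_neqAle zero_le le_one !andbT eq_sym. Qed.

Lemma hull_maximal S C :
  is_chain C -> C \subset ointerval zero one -> ranks C = S ->
  is_maximal_chain (selected S) (hull C).
Proof.
move=> /is_chainP chC /subsetP sub ES; apply/maximal_chainP; split.
- apply/subsetP => z; rewrite !inE => /orP[zC|->]; last by rewrite orbT.
  apply/orP; left; have := sub z zC; rewrite inE => /andP[/(rank_lt rkP) l1 /(rank_lt rkP) l2].
  rewrite rho0 in l1; rewrite rho1 in l2.
  have lt : (`|rho z|.-1 < n)%N by lia.
  apply/exists_inP; exists (Ordinal lt); last by apply/eqP => /=; lia.
  rewrite -ES inE; apply/exists_inP; exists z => //; apply/eqP => /=; lia.
- apply/is_chainP => u v; rewrite !inE => /or3P[uC|/eqP->|/eqP->] /or3P[vC|/eqP->|/eqP->];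
    try (by apply/le_comparable); try (by rewrite comparable_sym; apply/le_comparable).
  exact: chC.
- move=> z; rewrite !inE => /or3P[zS|/eqP->|/eqP->] zC; rewrite ?eqxx ?orbT //.
  case/exists_inP: zS => i; rewrite -ES inE => /exists_inP[w wC /eqP rw] /eqP rz.
  suff -> : z = w by rewrite wC.
  by apply: (rank_inj_comp rkP); [apply: zC; rewrite !inE wC | rewrite rz].
Qed.

Lemma maximal_hull S D : is_maximal_chain (selected S) D ->
  exists C, [/\ is_chain C, C \subset ointerval zero one, ranks C = S & D = hull C].
Proof.
move=> maxD; case/maximal_chainP: (maxD) => DA /is_chainP chD Dmax.
have zD : zero \in D.
  by apply: Dmax => [|w _]; [rewrite !inE eqxx orbT | apply/le_comparable].
have oD : one \in D.
  apply: Dmax => [|w _]; first by rewrite !inE eqxx !orbT.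
  by rewrite comparable_sym; apply/le_comparable.
exists (D :\: [set zero; one]); split.
- by apply/is_chainP => u v; rewrite !inE => /andP[_ uD] /andP[_ vD]; apply: chD.
- by apply/subsetP => z; rewrite ointerval01 !inE negb_or => /andP[].
- apply/setP => i; rewrite inE; apply/exists_inP/idP => [[z]|iS].
    rewrite !inE => /andP[zn zD'] /eqP rz; have := subsetP DA z zD'.
    rewrite !inE (negPf zn) orbF => /exists_inP[j jS]; rewrite rz => /eqP E.
    by suff -> : i = j by []; apply/val_inj => /=; lia.
  have [||||z zD' rz] := maximal_chain_rank (i := i.+1%:Z) _ _ _ maxD.
  + by rewrite !inE eqxx orbT.
  + by rewrite !inE eqxx !orbT.
  + by move=> z rz; rewrite !inE; apply/orP; left; apply/exists_inP; exists i; rewrite ?rz.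
  + by rewrite rho0 rho1; have := ltn_ord i; lia.
  exists z; last by rewrite rz.
  rewrite !inE zD' andbT negb_or; apply/andP; split; apply: contraPneq rz => ->.
    by rewrite rho0.
  by rewrite rho1; have := ltn_ord i; lia.
- apply/setP => z; rewrite !inE; case: (z =P zero) => [->|_]; first by rewrite zD !orbT.
  by case: (z =P one) => [->|_]; rewrite ?oD ?orbF //= !orbT.
Qed.

(** Maximal chains of a rank selection contain both extremes and exactly one
    element of each selected rank; dropping the extremes loses nothing. *)
Lemma flag_numberE (S : {set 'I_n}) :
  flag_number rho zero one S =
  #|[set C : {set T} | [&& is_chain C, C \subset ointerval zero one & ranks C == S]]|.
Proof.
rewrite /flag_number -[RHS](@card_in_imset _ _ hull); last first.
  move=> C C'; rewrite !inE => /and3P[_ /subsetP s _] /and3P[_ /subsetP s' _] E.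
  have H (X : {set T}) : {subset X <= ointerval zero one} -> X = hull X :&: ointerval zero one.
    move=> sX; apply/setP => z; rewrite in_setI ointerval01 !inE.
    have [zX|zX] := boolP (z \in X); first by have := sX z zX; rewrite ointerval01 => ->.
    by case: eqP => _; case: eqP => _.
  by rewrite (H C s) E -(H C' s').
apply: eq_card => D; rewrite inE; apply/idP/imsetP => [/maximal_hull[C [chC sC ES ->]]|[C]].
  by exists C; rewrite // inE chC sC ES eqxx.
by rewrite inE => /and3P[chC sC /eqP ES] ->; apply: hull_maximal.
Qed.

Lemma ab_index_psi : ab_index n rho zero one = psi var_a var_b rho zero one.
Proof.
have En : n = gap rho zero one by rewrite /gap rho0 rho1 subr0.
rewrite /ab_index /psi (partition_big ranks xpredT) //=.
apply: eq_bigr => S _; rewrite flag_numberE -sum1_card natr_sum scaler_suml.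
apply: eq_big => [C|C]; first by rewrite inE andbA.
rewrite inE => /and3P[_ _ /eqP <-]; rewrite scale1r /ab_word.
rewrite -(big_mkord xpredT (fun i =>
  if [exists z in C, rho z == rho zero + i.+1%:Z] then var_b else var_a - var_b)).
rewrite -En big_mkord; apply: eq_bigr => i _; rewrite inE.
by under [in RHS]eq_existsb do rewrite rho0 add0r.
Qed.

End Flags.
End RankSelection.

(** * The cd-index of an Eulerian poset *)

Section CdIndex.
Context (d : Order.disp_t) (T : finPOrderType d).

Lemma psi_shift (R : nzRingType) (a b : R) (r1 r2 : T -> int) (k : int) :
  (forall x, r1 x = r2 x + k) -> psi a b r1 =2 psi a b r2.
Proof.
move=> E x y; rewrite /psi.
have -> : gap r1 x y = gap r2 x y by rewrite /gap !E; congr (`|_|%N.-1); lia.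
apply: eq_bigr => C _; apply: eq_bigr => i _; congr (if _ then _ else _).
by apply: eq_existsb => z; rewrite !E addrAC (inj_eq (addIr k)).
Qed.

Lemma eulerian_shift (rho : T -> int) (zero one : T) (k : int) :
  eulerian_with rho zero one -> eulerian_with (fun x => rho x - k) zero one.
Proof.
case=> rkP zmin omax eul; split=> // [x y c|z z' zz'].
  by rewrite (rkP x y c) addrAC.
rewrite (eq_bigr (fun x => (-1) ^ rho x * (-1) ^ (- k))) => [|x _].
  by rewrite -mulr_suml eul // mul0r.
by rewrite exprzDr ?unitrN1.
Qed.

Lemma eulerian_poset_rank_gt0 (rho : T -> int) (zero one : T) :
  eulerian_with rho zero one -> zero < one -> (0 < poset_rank T)%N.
Proof.
move=> /(eulerian_shift (rho zero))[rkP zmin omax _] lt01.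
rewrite (poset_rankE rkP (unique_minimal_le zmin) (unique_maximal_le omax)) ?subrr //.
by have := rank_lt rkP lt01; lia.
Qed.

(** Existence and uniqueness of the polynomial turn the cd-index into the chain
    sum [psi], read through the injective substitution. *)
Lemma cd_subst_cd_index (rho : T -> int) (zero one : T) :
    eulerian_with rho zero one -> zero < one ->
  cd_subst (cd_index T) = psi var_a var_b rho zero one.
Proof.
move=> /(eulerian_shift (rho zero)); set r := fun x => rho x - rho zero.
move=> [rP zmin omax reul] lt01.
have zle := unique_minimal_le zmin; have ole := unique_maximal_le omax.
have r0 : r zero = 0 by rewrite /r subrr.
have psiE : psi var_a var_b rho zero one = psi var_a var_b r zero one.
  by apply: (psi_shift _ _ (k := rho zero)) => x; rewrite subrK.
rewrite psiE.
have rk : poset_rank T = `|r one|%N by apply: poset_rankE.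
have r1 : r one = (poset_rank T).-1.+1%:Z.
  by have := rank_lt rP lt01; rewrite rk r0; lia.
have [g gE] := psi_cd_image cd_subst_c cd_subst_d rP reul lt01.
have ex : exists p, is_cd_index T p.
  exists g; exists r, zero, one, (poset_rank T).-1; split=> //.
    by move: r1; rewrite rk; lia.
  rewrite ncsubst_cd gE; apply/esym/ab_index_psi => //.
have [r' [zero' [one' [n [[rP' zmin' omax' _] r0' rk' E]]]]] :
  is_cd_index T (cd_index T) := classical_sets.xgetPex 0 ex.
have Ez : zero' = zero by apply: zmin'.2; apply: zmin.1.
have Eo : one' = one by apply: omax'.2; apply: omax.1.
rewrite {}Ez {}Eo in E r0' zmin' omax'.
have Er x : r' x = r x + 0.
  by rewrite addr0; apply: (rank_functions_eq rP' rP (zle x)); rewrite r0 r0'.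
rewrite -ncsubst_cd E -(psi_shift _ _ Er); apply: ab_index_psi => //.
by rewrite Er addr0 r1 rk'.
Qed.

End CdIndex.

(** * Order embeddings *)

Section Embedding.
Context (dU dT : Order.disp_t) (U : finPOrderType dU) (T : finPOrderType dT).
Variable f : U -> T.
Hypothesis f_mono : {mono f : x y / x <= y}.
Hypothesis f_convex : forall x y w, f x <= w -> w <= f y -> exists u, f u = w.
Implicit Types (x y u v : U) (w : T).

Let f_inj : injective f := inc_inj f_mono.
Let f_lt : {mono f : x y / x < y} := leW_mono f_mono.

Lemma sum_embedding (V : nmodType) (Q : pred T) (F : T -> V) :
    (forall w, Q w -> exists u, f u = w) ->
  \sum_(w | Q w) F w = \sum_(u | Q (f u)) F (f u).
Proof.
move=> Qim; rewrite -(big_imset (h := f) (A := [pred u | Q (f u)])) /=; last first.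
  by move=> u v _ _; apply: f_inj.
apply: eq_bigl => w; apply/idP/imsetP => [Qw|[u Qu ->//]].
by have [u Eu] := Qim w Qw; exists u; rewrite ?inE ?Eu.
Qed.

Variable rho : T -> int.
Hypothesis rkP : is_rank_function rho.

Lemma covers_embedding x y : covers y x -> covers (f y) (f x).
Proof.
case/andP => xy /forallP none; rewrite /covers f_lt xy; apply/forallP => w.
apply/negP => /andP[xw wy].
have [u Eu] := f_convex (ltW xw) (ltW wy).
by have := none u; rewrite -!f_lt Eu xw wy.
Qed.

Lemma rank_embedding : is_rank_function (rho \o f).
Proof. by move=> x y /covers_embedding/rkP. Qed.

Lemma psi_embedding (R : nzRingType) (a b : R) x y :
  x < y -> psi a b (rho \o f) x y = psi a b rho (f x) (f y).
Proof.
move: {2}_.+1 (ltnSn #|ointerval x y|) => n; elim: n y => // n IH y lt_n xy.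
rewrite (psi_recr a b rank_embedding xy) (psi_recr a b rkP) ?f_lt //.
congr (_ + _); rewrite sum_embedding => [|w /andP[/ltW xw /ltW wy]]; last first.
  exact: f_convex xw wy.
apply: eq_big => [u|u /andP[xu uy]]; first by rewrite !f_lt.
rewrite IH // -ltnS; apply: leq_trans lt_n; rewrite ltnS.
apply: proper_card; apply/properP; split.
  by apply/subsetP => v; rewrite !inE => /andP[-> vu] /=; apply: lt_trans uy.
by exists u; [rewrite inE xu | rewrite inE ltxx andbF].
Qed.

Hypothesis euler : forall z z' : T,
  z < z' -> \sum_(x | z <= x <= z') (-1 : int) ^ rho x = 0.

Lemma euler_embedding x y : x < y ->
  \sum_(u | x <= u <= y) (-1 : int) ^ (rho \o f) u = 0.
Proof.
rewrite -f_lt => /euler; rewrite sum_embedding => [E|w /andP[xw wy]]; last first.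
  exact: f_convex xw wy.
by rewrite -[RHS]E; apply: eq_bigl => u; rewrite !f_mono.
Qed.

End Embedding.

Section Interval.
Context (d : Order.disp_t) (T : finPOrderType d) (rho : T -> int).
Hypothesis rkP : is_rank_function rho.
Hypothesis euler : forall z z' : T,
  z < z' -> \sum_(x | z <= x <= z') (-1 : int) ^ rho x = 0.

Lemma cd_index_interval (x y : T) : x < y ->
  cd_subst (cd_index (subposet (cinterval x y))) = psi var_a var_b rho x y.
Proof.
move=> xy; have xI : x \in cinterval x y by rewrite inE lexx ltW.
have yI : y \in cinterval x y by rewrite inE lexx ltW.
pose f : subposet (cinterval x y) -> T := val.
have fm : {mono f : u v / u <= v} by move=> u v; rewrite /f leEsub.
have fI u : x <= f u <= y by have := valP u; rewrite inE.
have fc u v w : f u <= w -> w <= f v -> exists t, f t = w.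
  move=> uw wv; have [/andP[xu _] /andP[_ vy]] := (fI u, fI v).
  have wI : w \in cinterval x y by rewrite inE (le_trans xu uw) (le_trans wv vy).
  by exists (Sub w wI); rewrite /f SubK.
pose x' : subposet (cinterval x y) := Sub x xI.
pose y' : subposet (cinterval x y) := Sub y yI.
have fx : f x' = x by rewrite /f SubK.
have fy : f y' = y by rewrite /f SubK.
have x'y' : x' < y' by rewrite -(leW_mono fm) fx fy.
rewrite -fx -fy -(psi_embedding fm fc rkP) //; apply: cd_subst_cd_index => //; split.
- exact: rank_embedding.
- by apply: le_unique_minimal => u; rewrite -fm fx; case/andP: (fI u).
- by apply: le_unique_maximal => u; rewrite -fm fy; case/andP: (fI u).
- exact: euler_embedding.
Qed.

End Interval.

(** * Cones *)

Section Cone.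
Context (R : nzRingType) (a b : R).
Let e := a - b.

Section Def.
Context (d : Order.disp_t) (T : finPOrderType d) (rho : T -> int) (zero : T).

(** All chains that end at [x], together with the letter [b] of [x] itself. *)
Definition cone_weight (x : T) : R := if x == zero then 1 else psi a b rho zero x * b.

(** The ab-index of the poset obtained from [L] by adding an element of rank [k]
    above all elements of [L]: the summand of [x] collects the chains whose
    largest element is [x]. *)
Definition cone (L : {set T}) (k : int) : R :=
  \sum_(x in L) cone_weight x * e ^+ `|k - rho x|%N.-1.

Lemma cone_setU1 (x : T) (L : {set T}) k : x \notin L ->
  cone (x |: L) k = cone_weight x * e ^+ `|k - rho x|%N.-1 + cone L k.
Proof. exact: big_setU1. Qed.

Hypotheses (rkP : is_rank_function rho) (zero_le : forall x, zero <= x).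

Lemma psi_cone t : zero < t -> psi a b rho zero t = cone [set x | x < t] (rho t).
Proof.
move=> lt0; rewrite psi_recr // /cone [in RHS](bigD1 zero) ?inE //=.
rewrite /cone_weight eqxx mul1r; congr (_ + _); apply: eq_big => [x|x /andP[x0 _]].
  by rewrite inE lt_neqAle zero_le andbT eq_sym andbC.
by rewrite gt_eqF.
Qed.

End Def.

Lemma cone_embedding (dU dT : Order.disp_t) (U : finPOrderType dU)
    (T : finPOrderType dT) (f : U -> T) (rho : T -> int) (u0 : U) (V : {set U}) k :
    {mono f : x y / x <= y} -> (forall u w, w <= f u -> exists v, f v = w) ->
    is_rank_function rho -> (forall x, u0 <= x) ->
  cone rho (f u0) (f @: V) k = cone (rho \o f) u0 V k.
Proof.
move=> fm flow rkP le0; have finj : injective f := inc_inj fm.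
rewrite /cone big_imset => [|u v _ _]; last exact: finj.
apply: eq_bigr => u _; congr (_ * _); rewrite /cone_weight (inj_eq finj).
case: eqP => // /eqP u_n0; rewrite (psi_embedding fm _ rkP) // => [x y w _|].
  exact: flow.
by rewrite lt_neqAle eq_sym u_n0 le0.
Qed.

End Cone.

(** * Adding a top element *)

Section Capped.
Context (d : Order.disp_t) (T : finPOrderType d) (rho : T -> int) (zero : T).

(** The conditions for [L], completed by an element of rank [k] above all its
    elements, to be Eulerian inside an Eulerian poset. *)
Definition capped (L : {set T}) (k : int) : Prop :=
  [/\ forall x y, x \in L -> y <= x -> y \in L,
      zero \in L,
      forall x, x \in L -> (forall y, y \in L -> ~~ (x < y)) -> k = rho x + 1
    & forall x, x \in L -> \sum_(y in L | x <= y) (-1 : int) ^ rho y = - (-1) ^ k].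

Hypotheses (rkP : is_rank_function rho) (zero_le : forall x, zero <= x).
Hypothesis euler : forall z z' : T,
  z < z' -> \sum_(x | z <= x <= z') (-1 : int) ^ rho x = 0.

Context (dU : Order.disp_t) (U : finPOrderType dU) (g : U -> T).
Hypothesis g_mono : {mono g : x y / x <= y}.
Variables (L : {set T}) (k : int).
Hypotheses (gL : g @: [set: U] = L) (capL : capped L k).

Let rankP (x : with_top U) : int := if x is Some u then rho (g u) else k.

Let inL u : g u \in L. Proof. by rewrite -gL imset_f. Qed.

Let imL w : w \in L -> exists u, g u = w.
Proof. by rewrite -gL => /imsetP[u _ ->]; exists u. Qed.

Let some_mono : {mono (@Some U : U -> with_top U) : x y / x <= y}.
Proof. by []. Qed.

Let le_none (x : with_top U) : x <= None. Proof. by case: x. Qed.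

Let g_low u w : w <= g u -> exists v, g v = w.
Proof. by case: capL => low _ _ _ /(low _ _ (inL u)); apply: imL. Qed.

Let some_low (u : U) (w : with_top U) : w <= Some u -> exists v, Some v = w.
Proof. by case: w => [v _|//]; exists v. Qed.

Let some_lt (u : U) : (Some u : with_top U) < None.
Proof. by rewrite lt_neqAle le_none andbT. Qed.

Lemma with_top_rank : is_rank_function rankP.
Proof.
move=> [u|] [v|] /=.
- case/andP=> uv /forallP none; apply: rkP; apply: (covers_embedding g_mono).
    by move=> x y w _; apply: g_low.
  apply/andP; split; first by rewrite -(leW_mono some_mono).
  by apply/forallP => w; have := none (Some w); rewrite !(leW_mono some_mono).
- case/andP=> uv /forallP none; case: capL => _ _ capmax _.
  apply: capmax; first exact: inL.
  move=> y /imL[w <-]; rewrite (leW_mono g_mono).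
  by have := none (Some w); rewrite some_lt andbT (leW_mono some_mono).
- by case/andP => /ltW.
- by rewrite /covers ltxx.
Qed.

Lemma with_top_euler (z z' : with_top U) : z < z' ->
  \sum_(x | z <= x <= z') (-1 : int) ^ rankP x = 0.
Proof.
case: z z' => [u|] [v|]; [ | | by move/ltW | by rewrite ltxx].
  rewrite (leW_mono some_mono) => uv.
  rewrite (sum_embedding some_mono) => [|w /andP[_]]; last exact: some_low.
  by rewrite -[RHS](euler_embedding g_mono _ euler uv) // => x y w _; apply: g_low.
move=> _; rewrite (bigD1 None) ?le_none //=.
rewrite (sum_embedding some_mono) => [|w']; last first.
  by case: w' => [w _|]; [exists w | rewrite andbF].
case: capL => _ _ _ /(_ (g u) (inL u)); rewrite (sum_embedding g_mono); last first.
  by move=> w /andP[/imL].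
move=> E; rewrite -[RHS](addrN ((-1) ^ k)) -E; congr (_ + _).
by apply: eq_bigl => v; rewrite inL g_mono some_mono le_none !andbT.
Qed.

Lemma with_top_cone :
  cd_subst (cd_index (with_top U)) = cone var_a var_b rho zero L k.
Proof.
case: (capL) => _ /imL[u0 g0] _ _.
have u0le u : u0 <= u by rewrite -g_mono g0.
have eulW : eulerian_with rankP (Some u0) None.
  split; [exact: with_top_rank | | exact: le_unique_maximal | exact: with_top_euler].
  by apply: le_unique_minimal => -[u|]; rewrite ?le_none ?some_mono.
rewrite (cd_subst_cd_index eulW) ?some_lt // psi_cone ?some_lt //; last first.
- by case=> [u|]; rewrite ?le_none ?some_mono.
- exact: with_top_rank.
rewrite -gL -g0 cone_embedding //.
have -> : [set x : with_top U | x < None] = Some @: [set: U].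
  apply/setP => -[u|]; rewrite inE ?some_lt ?ltxx.
    by apply/esym/imsetP; exists u.
  by apply/esym/negP => /imsetP[].
by rewrite (cone_embedding _ _ _ _ some_mono some_low with_top_rank).
Qed.

End Capped.

(** * Semisuspensions *)

Section Semisuspension.
Context (dU dS : Order.disp_t) (U : finPOrderType dU) (S : finPOrderType dS).
Variables (hz one : S) (f : U -> S).
Hypotheses (f_mono : {mono f : x y / x <= y})
  (f_im : f @: [set: U] = [set: S] :\: [set hz; one])
  (hz_one : hz != one) (le_one : forall s, s <= one)
  (hz_max : forall s, s != one -> ~~ (hz < s)).

Let f_inj : injective f := inc_inj f_mono.

Lemma semisusp_cases s : [\/ s = hz, s = one | exists u, s = f u].
Proof.
have [->|s_hz] := eqVneq s hz; first by constructor 1.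
have [->|s_one] := eqVneq s one; first by constructor 2.
have : s \in f @: [set: U] by rewrite f_im !inE negb_or s_hz s_one.
by case/imsetP=> u _ ->; constructor 3; exists u.
Qed.

Lemma f_neq u : (f u == hz) = false /\ (f u == one) = false.
Proof.
have : f u \in f @: [set: U] by rewrite imset_f.
by rewrite f_im !inE negb_or => /andP[/andP[/negPf -> /negPf ->] _].
Qed.

Lemma f_lt_one u : f u < one.
Proof. by rewrite lt_neqAle le_one andbT; case: (f_neq u) => _ ->. Qed.

Lemma hz_lt_one : hz < one.
Proof. by rewrite lt_neqAle hz_one le_one. Qed.

Lemma hz_le_f u : (hz <= f u) = false.
Proof.
case: (f_neq u) => fhz /negbT /hz_max /negPf; rewrite lt_neqAle eq_sym fhz /= => -> //.
Qed.

Lemma one_le_f u : (one <= f u) = false.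
Proof. by apply/negbTE/negP => /(lt_le_trans (f_lt_one u)); rewrite ltxx. Qed.

Lemma f_low u w : w <= f u -> exists v, f v = w.
Proof.
case: (semisusp_cases w) => [->|->|[v ->]]; last by exists v.
  by rewrite hz_le_f.
by rewrite one_le_f.
Qed.

Lemma sum_semisusp (V : nmodType) (P : pred S) (F : S -> V) :
  \sum_(s | P s) F s = \sum_(u | P (f u)) F (f u)
    + ((if P hz then F hz else 0) + (if P one then F one else 0)).
Proof.
rewrite (bigID (mem (f @: [set: U]))) /=; congr (_ + _).
  rewrite (sum_embedding f_mono) => [|w /andP[_ /imsetP[u _ ->]]]; last by exists u.
  by apply: eq_bigl => u; rewrite imset_f ?andbT.
rewrite big_mkcond /= (bigD1 hz) //= (bigD1 one) /=; last by rewrite eq_sym.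
rewrite !f_im !inE !eqxx ?orbT /= !andbT big1 ?addr0 // => s /andP[s_hz s_one].
by rewrite !inE negb_or s_hz s_one andbF.
Qed.

End Semisuspension.

Lemma sum_sign_mod2 (I : finType) (P : pred I) (F : I -> int) :
  exists m : int, \sum_(i | P i) (-1 : int) ^ F i = #|P|%:Z + m * 2.
Proof.
have sgn (n : int) : exists m : int, (-1 : int) ^ n = 1 + m * 2.
  suff H k : exists m : int, (-1 : int) ^+ k = 1 + m * 2.
    case: n => k; first exact: H.
    have [m E] := H k.+1; exists m; rewrite -E NegzE -exprnN.
    by rewrite -signr_odd; case: (odd _); rewrite ?invrN1 ?invr1.
  elim: k => [|k [m IH]]; first by exists 0; rewrite mul0r.
  by exists (- 1 - m); rewrite exprS IH mulN1r; ring.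
have -> : #|P|%:Z = \sum_(i | P i) (1 : int) by rewrite -natz -sum1_card natr_sum.
elim/big_ind2: _ => [|p g p' g' [m ->] [m' ->]|z _]; last exact: sgn.
  by exists 0; rewrite mul0r addr0.
by exists (m + m'); rewrite mulrDl addrACA.
Qed.

Lemma signz_pred (n : int) : (-1 : int) ^ (n - 1) = - (-1) ^ n.
Proof. by rewrite exprzDr ?unitrN1 // mulrN1. Qed.

Fact int_between (i j : int) : j - 2 < i -> i < j -> i = j - 1.
Proof. lia. Qed.

Section SemisuspensionRank.
Context (d : Order.disp_t) (T : finPOrderType d) (rho : T -> int).
Hypothesis rkP : is_rank_function rho.
Hypothesis euler : forall z z' : T,
  z < z' -> \sum_(x | z <= x <= z') (-1 : int) ^ rho x = 0.
Context (dU dS : Order.disp_t) (U : finPOrderType dU) (S : finPOrderType dS).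
Variables (g : U -> T) (u0 : U) (k : int).
Hypotheses (g_mono : {mono g : x y / x <= y})
  (g_low : forall u w, w <= g u -> exists v, g v = w)
  (u0_le : forall u, u0 <= u)
  (g_max : forall u, (forall v, ~~ (u < v)) -> k = rho (g u) + 1).
Variables (hz one : S) (f : U -> S).
Hypotheses (f_mono : {mono f : x y / x <= y})
  (f_im : f @: [set: U] = [set: S] :\: [set hz; one])
  (hz_one : hz != one) (le_one : forall s, s <= one)
  (hz_max : forall s, s != one -> ~~ (hz < s)).

Let f_inj : injective f := inc_inj f_mono.
Let cases := semisusp_cases f_im.
Let fneq := f_neq f_im.
Let flt1 := f_lt_one f_im le_one.
Let hzlt1 := hz_lt_one hz_one le_one.
Let hzf := hz_le_f f_im hz_max.
Let onef := one_le_f f_im le_one.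
Let flow := f_low f_im le_one hz_max.
Let sumS := sum_semisusp f_mono f_im hz_one.

Let one_hz : (one <= hz) = false.
Proof. exact: lt_geF hzlt1. Qed.

Lemma semisusp_covers_top : covers one hz.
Proof.
rewrite /covers hzlt1; apply/forallP => s; apply/negP => /andP[hs s1].
by have := hz_max (negbT (lt_eqF s1)); rewrite hs.
Qed.

Section Eulerian.
Variable V : {set U}.
Hypotheses (f_le_hz : forall u, (f u <= hz) = (u \in V)) (u0V : u0 \in V)
  (V_max : forall u, u \in V -> (forall v, v \in V -> ~~ (u < v)) ->
     k - 1 = rho (g u) + 1)
  (V_sum : forall u, u \in V ->
     \sum_(v in V | u <= v) (-1 : int) ^ rho (g v) = - (-1) ^ (k - 1))
  (U_sum : forall u, \sum_(v | u <= v) (-1 : int) ^ rho (g v) =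
     if u \in V then 0 else - (-1) ^ k).

Let rS (s : S) : int :=
  if [pick u | f u == s] is Some u then rho (g u)
  else if s == hz then k - 1 else k.

Let rS_f u : rS (f u) = rho (g u).
Proof.
rewrite /rS; case: pickP => [v /eqP /f_inj -> //|none].
by have := none u; rewrite eqxx.
Qed.

Let rS_hz : rS hz = k - 1.
Proof.
rewrite /rS; case: pickP => [v|_]; last by rewrite eqxx.
by case: (fneq v) => ->.
Qed.

Let rS_one : rS one = k.
Proof.
rewrite /rS; case: pickP => [v|_]; last by rewrite eq_sym (negPf hz_one).
by case: (fneq v) => _ ->.
Qed.

Let f_lt : {mono f : x y / x < y} := leW_mono f_mono.

Let f_lt_hz u : (f u < hz) = (u \in V).
Proof. by rewrite lt_neqAle f_le_hz; case: (fneq u) => ->. Qed.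

Let semisusp_rank : is_rank_function rS.
Proof.
move=> z z'; case: (cases z) => [->|->|[u ->]]; case: (cases z') => [->|->|[v ->]] c.
- by move/covers_lt: c; rewrite ltxx.
- by rewrite rS_one rS_hz subrK.
- by move/covers_lt/ltW: c; rewrite hzf.
- by move/covers_lt/ltW: c; rewrite one_hz.
- by move/covers_lt: c; rewrite ltxx.
- by move/covers_lt/ltW: c; rewrite onef.
- case/andP: c; rewrite f_lt_hz rS_hz rS_f => uV /forallP none.
  by apply: V_max => // v vV; have := none (f v); rewrite f_lt f_lt_hz vV andbT.
- case/andP: c => _ /forallP none; rewrite rS_one rS_f.
  by apply: g_max => v; have := none (f v); rewrite f_lt flt1 andbT.
- case/andP: c; rewrite f_lt => uv /forallP none; rewrite !rS_f; apply: rkP.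
  apply: (covers_embedding g_mono) => [x y w _|]; first exact: g_low.
  by rewrite /covers uv; apply/forallP => w; have := none (f w); rewrite !f_lt.
Qed.

Let semisusp_euler z z' : z < z' -> \sum_(x | z <= x <= z') (-1 : int) ^ rS x = 0.
Proof.
rewrite sumS; under eq_bigr do rewrite rS_f.
rewrite rS_hz rS_one.
case: (cases z) => [->|->|[u ->]]; case: (cases z') => [->|->|[v ->]] lt.
- by move: lt; rewrite ltxx.
- rewrite big_pred0 => [|u]; last by rewrite hzf.
  by rewrite !lexx ltW // signz_pred add0r addNr.
- by move/ltW: lt; rewrite hzf.
- by move/ltW: lt; rewrite one_hz.
- by move: lt; rewrite ltxx.
- by move/ltW: lt; rewrite onef.
- have uV : u \in V by rewrite -f_lt_hz.
  rewrite f_le_hz uV lexx one_hz andbF addr0 /=.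
  rewrite (eq_bigl (fun v => (v \in V) && (u <= v))) ?V_sum ?addNr // => v.
  by rewrite f_mono f_le_hz andbC.
- rewrite (eq_bigl (fun v => u <= v)) => [|v]; last by rewrite f_mono le_one andbT.
  rewrite U_sum f_le_hz !le_one !andbT signz_pred.
  by case: ifP => _; rewrite ?addNr ?add0r ?addNr.
- rewrite hzf onef !andbF !addr0.
  have uv : u < v by rewrite -f_lt.
  rewrite -[RHS](euler_embedding g_mono _ euler uv) => [|x y w _]; last exact: g_low.
  by apply: eq_bigl => w; rewrite !f_mono.
Qed.

(** The alternating sums of the intervals that involve the two new elements are
    the given alternating sums over [V] and [U], completed by the signs of these
    two elements. *)
Lemma semisusp_eulerian : eulerian S.
Proof.
exists rS, (f u0), one; split=> //; last exact: le_unique_maximal.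
apply: le_unique_minimal => s; case: (cases s) => [->|->|[u ->]].
- by rewrite f_le_hz.
- exact: le_one.
- by rewrite f_mono.
Qed.

End Eulerian.

Hypothesis rho_u0 : rho (g u0) = 0.

(** Conversely, the order and the ranks of a semisuspension are determined by the
    poset [U]; whether an element lies below [hz] is read off from parities. *)
Section Recover.
Hypothesis S_eulerian : eulerian S.

Lemma semisusp_normalize :
  exists2 r : S -> int, eulerian_with r (f u0) one & r \o f =1 rho \o g.
Proof.
have [rS [zeroS [oneS eulS]]] := S_eulerian.
have [rkS zmin omax _] := eulS.
have zle := unique_minimal_le zmin.
have E1 : oneS = one by apply/le_anti; rewrite le_one (unique_maximal_le omax).
have [u1 fu1] := flow (zle (f u0)).
have u10 : u1 = u0 by apply/le_anti; rewrite u0_le -f_mono fu1 zle.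
have E0 : zeroS = f u0 by rewrite -u10 fu1.
exists (fun s => rS s - rS (f u0)); first by rewrite -E0 -E1; apply: eulerian_shift.
have [rk' _ _ _] := eulerian_shift (rS (f u0)) eulS.
move=> u; apply: (rank_functions_eq _ _ (u0_le u)); last by rewrite /= subrr rho_u0.
- by apply: (rank_embedding f_mono _ rk') => x y w _; apply: flow.
- by apply: (rank_embedding g_mono _ rkP) => x y w _; apply: g_low.
Qed.

Variable r : S -> int.
Hypotheses (eulS : eulerian_with r (f u0) one) (rE : r \o f =1 rho \o g).

Let rkS : is_rank_function r. Proof. by case: eulS. Qed.
Let r_f u : r (f u) = rho (g u). Proof. exact: rE. Qed.
Let f_lt : {mono f : x y / x < y} := leW_mono f_mono.

Let euler_top u :
  \sum_(v | u <= v) (-1 : int) ^ r (f v) +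
    ((if f u <= hz then (-1) ^ r hz else 0) + (-1) ^ r one) = 0.
Proof.
case: eulS => _ _ _ /(_ _ _ (flt1 u)); rewrite sumS !le_one !andbT => E.
by rewrite -[RHS]E; congr (_ + _); apply: eq_bigl => v; rewrite f_mono le_one andbT.
Qed.

(** The alternating sum over the interval from [f u] to the top vanishes, so this
    interval has an even number of elements. *)
Let count_top u : odd #|[set v | u < v]| = (f u <= hz).
Proof.
have := euler_top u; have [m ->] := sum_sign_mod2 (fun v => u <= v) (r \o f).
have [m1] := sum_sign_mod2 (pred1 hz) r; rewrite big_pred1_eq card1 => ->.
have [m2] := sum_sign_mod2 (pred1 one) r; rewrite big_pred1_eq card1 => ->.
rewrite (cardD1 u) unfold_in /= lexx.
have -> : #|[predD1 (fun v => u <= v) & u]| = #|[set v | u < v]|.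
  by apply: eq_card => v; rewrite !inE lt_neqAle eq_sym.
move: #|[set v | u < v]| => N; have := odd_double_half N; rewrite -muln2.
by case: (odd N); case: (f u <= hz) => /=; lia.
Qed.

(** A maximal element of [U] cannot lie below [hz], for its interval up to the top
    would then have three elements; hence it is covered by the top. *)
Lemma rank_semisusp_top : r one = k.
Proof.
have [u _ umax] := @Order.TotalTheory.arg_maxP _ _ _ u0 predT (rho \o g) isT.
have max_u v : ~~ (u < v).
  apply/negP => uv; have := umax v isT; rewrite /= leNgt (rank_lt rkP) //.
  by rewrite (leW_mono g_mono).
rewrite (g_max max_u) -r_f; apply: rkS; rewrite /covers flt1; apply/forallP => s.
apply/negP; case: (cases s) => [->|->|[v ->]]; rewrite ?ltxx ?andbF //.
  have := count_top u; rewrite (_ : [set v | u < v] = set0) ?cards0.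
    by move=> /esym/negbT/negP H /andP[/ltW].
  by apply/setP => v; rewrite !inE; apply/negbTE.
by rewrite f_lt (negPf (max_u v)).
Qed.

Lemma rank_semisusp_hz : r hz = k - 1.
Proof. by have := rkS semisusp_covers_top; rewrite rank_semisusp_top; lia. Qed.

(** If exactly one element of [U] lies above [z], evenness forces [hz] to lie above
    [z] as well. Conversely an element below [hz] lies below some [z] of corank 2,
    and intervals of length 2 have exactly two middle elements. *)
Lemma boundary_semisusp u : (u \in boundary U) = (f u <= hz).
Proof.
rewrite inE; apply/existsP/idP => [[z /andP[uz /eqP n1]]|uhz].
  apply: (@le_trans _ _ (f z)); first by rewrite f_mono.
  by rewrite -count_top n1.
have fuhz : f u < hz by rewrite lt_neqAle uhz; case: (fneq u) => ->.
have [w [uw whz rw]] : exists w, [/\ f u <= w, w < hz & r w = k - 2].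
  have := rank_lt rkS fuhz; rewrite rank_semisusp_hz => lt.
  have [E|n] := eqVneq (r (f u)) (k - 2); first by exists (f u).
  have [|w [uw wh rw]] := rank_between rkS (i := k - 2) fuhz.
    by rewrite rank_semisusp_hz; lia.
  by exists w; split => //; apply: ltW.
case: (cases w) => [E|E|[z E]]; first by rewrite E ltxx in whz.
  by move/ltW: whz; rewrite E one_hz.
rewrite {w}E in uw whz rw; exists z; rewrite -f_mono uw /=.
have := euler_top z; rewrite (ltW whz) rank_semisusp_hz rank_semisusp_top.
rewrite (bigD1 z) //= (eq_bigr (fun _ => (-1 : int) ^ (k - 1))); last first.
  move=> v /andP[zv v_z]; congr (_ ^ _).
  have zv' : f z < f v by rewrite f_lt lt_neqAle eq_sym v_z.
  apply: int_between; last by rewrite -rank_semisusp_top; apply: rank_lt (flt1 v).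
  by rewrite -rw; apply: rank_lt zv'.
rewrite sumr_const rw.
have -> : #|[pred v | z <= v & v != z]| = #|[set v | z < v]|.
  by apply: eq_card => v; rewrite !inE lt_neqAle eq_sym andbC.
have -> : k - 2 = (k - 1) - 1 by rewrite -addrA.
rewrite !signz_pred opprK mulNrn => E.
have := congr1 (fun i => (-1) ^ k * i) E.
rewrite mulr0 !mulrDr !mulrN mulrnAr sign_sqr natz.
by move: #|_| => N; lia.
Qed.

(** Chains of [S] below the top that avoid [hz] give the first cone, the others
    the second one. *)
Lemma psi_semisusp (R : nzRingType) (a b : R) :
  psi a b r (f u0) one =
  cone a b rho (g u0) (g @: [set: U]) k +
  cone a b rho (g u0) (g @: boundary U) (k - 1) * b.
Proof.
have rfg : r \o f = rho \o g by apply/boolp.funext.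
have ule s : f u0 <= s by case: eulS => _ /unique_minimal_le.
have fV (V : {set U}) m : cone a b r (f u0) (f @: V) m = cone a b rho (g u0) (g @: V) m.
  rewrite (cone_embedding _ _ _ _ f_mono) // rfg -(cone_embedding _ _ _ _ g_mono) //.
have u0hz : f u0 < hz.
  by rewrite lt_neqAle ule; case: (fneq u0) => ->.
rewrite psi_cone ?flt1 // rank_semisusp_top.
have -> : [set s | s < one] = hz |: f @: [set: U].
  apply/setP => s; rewrite !inE f_im !inE negb_or.
  rewrite lt_neqAle le_one andbT.
  by case: (s =P hz) => [->|] //=; rewrite ?hz_one ?andbT.
rewrite cone_setU1; last by rewrite f_im !inE eqxx.
rewrite [LHS]addrC fV; congr (_ + _).
have -> : `|k - r hz|%N.-1 = 0%N by rewrite rank_semisusp_hz; lia.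
rewrite expr0 mulr1 /cone_weight gt_eqF //.
rewrite psi_cone // rank_semisusp_hz -fV; congr (cone _ _ _ _ _ _ * _).
apply/setP => s; rewrite inE; apply/idP/imsetP => [shz|[u ub ->]].
  have [E|E|[u E]] := cases s; first by rewrite E ltxx in shz.
    by move/ltW: shz; rewrite E one_hz.
  by exists u; rewrite // boundary_semisusp -E ltW.
rewrite lt_neqAle -boundary_semisusp ub andbT.
by case: (fneq u) => ->.
Qed.

End Recover.
End SemisuspensionRank.

(** * Local cd-indices *)

Section LocalCdIndex.
Context (d : Order.disp_t) (T : finPOrderType d) (rho : T -> int).
Hypothesis rkP : is_rank_function rho.
Hypothesis euler : forall z z' : T,
  z < z' -> \sum_(x | z <= x <= z') (-1 : int) ^ rho x = 0.
Context (dU : Order.disp_t) (U : finPOrderType dU).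
Variables (g : U -> T) (u0 : U) (k : int).
Hypotheses (g_mono : {mono g : x y / x <= y})
  (g_low : forall u w, w <= g u -> exists v, g v = w)
  (zero_le : forall x, g u0 <= x) (rho0 : rho (g u0) = 0)
  (g_max : forall u, (forall v, ~~ (u < v)) -> k = rho (g u) + 1).

Local Notation a := var_a.
Local Notation b := var_b.

Lemma cd_index_semisusp (dS : Order.disp_t) (S : finPOrderType dS) (hz : S) :
    is_semisuspension U hz ->
  cd_subst (cd_index S) = cone a b rho (g u0) (g @: [set: U]) k +
    cone a b rho (g u0) (g @: boundary U) (k - 1) * b.
Proof.
case=> eulS _ [one [omax hz_one hz_max [f [fm fim]]]].
have ole := unique_maximal_le omax.
have u0le u : u0 <= u by rewrite -g_mono.
have [r eulr rE] :=
  semisusp_normalize rkP g_mono g_low u0le fm fim ole hz_max rho0 eulS.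
rewrite (cd_subst_cd_index eulr); last exact: f_lt_one fim ole u0.
exact: (psi_semisusp rkP g_mono g_low u0le g_max fm fim hz_one ole hz_max rho0 eulr rE).
Qed.

Hypothesis ex_semisusp : exists (dS : Order.disp_t) (S : finPOrderType dS) (hz : S),
  is_semisuspension U hz.
Hypothesis cap_boundary : capped rho (g u0) (g @: boundary U) (k - 1).

Lemma cd_index_with_top_boundary :
  cd_subst (cd_index (with_top (subposet (boundary U)))) =
  cone a b rho (g u0) (g @: boundary U) (k - 1).
Proof.
pose h (v : subposet (boundary U)) : T := g (val v).
apply: (@with_top_cone _ _ _ _ rkP zero_le euler _ _ h) => //.
  by move=> u v; rewrite /h g_mono leEsub.
apply/setP => w; apply/imsetP/imsetP => [[v _ ->]|[u ub ->]].
  by exists (val v); first exact: valP.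
by exists (Sub u ub) => //; rewrite /h SubK.
Qed.

(** The value does not depend on the semisuspension, because both cones are
    computed in [U]. *)
Lemma cd_subst_local_cd_index :
  cd_subst (local_cd_index U) =
  cone a b rho (g u0) (g @: [set: U]) k
  + cone a b rho (g u0) (g @: boundary U) (k - 1) * b
  - cone a b rho (g u0) (g @: boundary U) (k - 1) * (a + b).
Proof.
have ex : exists p, is_local_cd_index U p.
  have [dS [S [hz hS]]] := ex_semisusp.
  eexists; split; last by exists dS, S, hz; split; [exact: hS | reflexivity].
  by apply/card_gt0P; exists u0.
have [_ [dS [S [hz [hS E]]]]] : is_local_cd_index U (local_cd_index U) :=
  classical_sets.xgetPex 0 ex.
rewrite E raddfB /= -(cd_index_semisusp hS); congr (_ - _).
by rewrite rmorphM /= cd_subst_c cd_index_with_top_boundary.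
Qed.

End LocalCdIndex.

(** * Join-admissible elements *)

Section Join.
Context (d : Order.disp_t) (T : finPOrderType d) (rho : T -> int).
Hypothesis rkP : is_rank_function rho.
Hypothesis euler : forall z z' : T,
  z < z' -> \sum_(x | z <= x <= z') (-1 : int) ^ rho x = 0.
Variables (zero q : T).
Hypotheses (zero_le : forall x, zero <= x) (rho0 : rho zero = 0)
  (q_zero : q != zero) (q_join : join_admissible q).
Implicit Types (x y z w : T).

Local Notation j x := (pjoin x q).
Local Notation sgn x := ((-1 : int) ^ rho x).

Lemma pjoin_le x y : (j x <= y) = (x <= y) && (q <= y).
Proof.
have : is_join x q (j x).
  rewrite /pjoin; case: pickP => //= none; have [u ju] := q_join x.
  by have := none u; rewrite ju.
case/and3P => xj qj /forallP jmin; apply/idP/andP => [jy|[xy qy]].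
  by rewrite (le_trans xj jy) (le_trans qj jy).
by have := jmin y; rewrite xy qy.
Qed.

Lemma le_pjoin x : x <= j x.
Proof. by have := lexx (j x); rewrite pjoin_le => /andP[]. Qed.

Lemma q_le_pjoin x : q <= j x.
Proof. by have := lexx (j x); rewrite pjoin_le => /andP[]. Qed.

Lemma pjoin_mono x y : x <= y -> j x <= j y.
Proof. by move=> xy; rewrite pjoin_le (le_trans xy (le_pjoin y)) q_le_pjoin. Qed.

Lemma outside_lt_pjoin x : ~~ (q <= x) -> x < j x.
Proof.
move=> xX; rewrite lt_neqAle le_pjoin andbT.
by apply: contraNneq xX => ->; apply: q_le_pjoin.
Qed.

Lemma mem_fiber_le x y : q <= y -> (x \in fiber_le q y) = ~~ (q <= x) && (x <= y).
Proof. by move=> qy; rewrite !inE pjoin_le qy andbT. Qed.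

Lemma mem_fiber_lt x y : (x \in fiber_lt q y) = ~~ (q <= x) && (j x < y).
Proof. by rewrite !inE. Qed.

Section Sums.
Variable x : T.
Hypothesis xX : ~~ (q <= x).

(** The elements of an interval from [x] above [q] form the interval from the
    join, hence contribute 0 unless the interval ends at the join. *)
Lemma sum_outside_below y : j x <= y ->
  \sum_(z | ~~ (q <= z) && (x <= z <= y)) sgn z = if j x == y then - sgn y else 0.
Proof.
move=> jy; have := euler (lt_le_trans (outside_lt_pjoin xX) jy).
rewrite (bigID (fun z => q <= z)) /=.
rewrite (eq_bigl (fun z => j x <= z <= y)) => [|z]; last first.
  by rewrite pjoin_le; case: (x <= z); case: (z <= y); case: (q <= z).
rewrite [X in _ + X](eq_bigl (fun z => ~~ (q <= z) && (x <= z <= y))) => [|z]; last first.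
  by rewrite andbC.
case: eqP => [<-|/eqP ne].
  rewrite (big_pred1 (j x)) => [|z]; last by rewrite -eq_le eq_sym.
  by move=> E; apply/eqP; rewrite -addr_eq0 addrC E.
by rewrite euler ?add0r // lt_neqAle ne.
Qed.

(** Inverting the sums of [sum_outside_below] over the interval from the join to
    [y], by induction on [y]. *)
Lemma sum_join_fiber y : j x <= y ->
  \sum_(z | ~~ (q <= z) && (x <= z) && (j z == y)) sgn z = - sgn y.
Proof.
move: {2}_.+1 (ltnSn #|[set w | w < y]|) => n; elim: n y => // n IH y lt_n jy.
have := sum_outside_below jy.
rewrite (partition_big (fun z => j z) (fun w => j x <= w <= y)) /=; last first.
  move=> z /and3P[zX xz zy]; rewrite pjoin_mono // pjoin_le zy.
  by apply: le_trans jy; apply: q_le_pjoin.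
rewrite (bigD1 y) ?jy ?lexx //=.
have Efib w : w <= y -> \sum_(z | ~~ (q <= z) && (x <= z <= y) && (j z == w)) sgn z =
    \sum_(z | ~~ (q <= z) && (x <= z) && (j z == w)) sgn z.
  move=> wy; apply: eq_bigl => z; case: (j z =P w) => [E|_]; last by rewrite !andbF.
  by rewrite (le_trans (le_pjoin z)) ?E // !andbT.
rewrite Efib // [X in _ + X](eq_bigr (fun w => - sgn w)); last first.
  move=> w /andP[/andP[jw wy] w_y].
  rewrite Efib // IH // -ltnS; apply: leq_trans lt_n; rewrite ltnS.
  have wy' : w < y by rewrite lt_neqAle w_y.
  apply: proper_card; apply/properP; split.
    by apply/subsetP => v; rewrite !inE => /lt_trans; apply.
  by exists w; [rewrite inE | rewrite inE ltxx].
rewrite sumrN; case: eqP => [E|/eqP ne].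
  rewrite [X in _ - X]big_pred0 ?oppr0 ?addr0 // => w; rewrite E -eq_le eq_sym.
  by case: (w == y).
have : j x < y by rewrite lt_neqAle ne.
move/euler; rewrite (bigD1 y) ?jy ?lexx //= => /eqP.
rewrite addr_eq0 => /eqP -> /eqP; rewrite subr_eq0 => /eqP ->.
by rewrite opprK.
Qed.

Lemma sum_fiber_lt y : j x < y ->
  \sum_(z in fiber_lt q y | x <= z) sgn z = sgn y.
Proof.
move=> jy; have := sum_outside_below (ltW jy); rewrite lt_eqF //.
rewrite (bigID (fun z => j z == y)) /=.
rewrite (eq_bigl (fun z => ~~ (q <= z) && (x <= z) && (j z == y))) => [|z]; last first.
  case: (j z =P y) => [E|_]; last by rewrite !andbF.
  by rewrite -{1}E le_pjoin !andbT.
rewrite (sum_join_fiber (ltW jy)) addrC.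
rewrite (eq_bigl (fun z => (z \in fiber_lt q y) && (x <= z))) => [/eqP|z].
  by rewrite subr_eq0 => /eqP.
rewrite mem_fiber_lt lt_neqAle pjoin_le (le_trans (q_le_pjoin x) (ltW jy)) andbT.
by case: (q <= z); case: (x <= z); case: (z <= y); case: (j z == y).
Qed.

End Sums.

Lemma sgn_neq0 x : sgn x != 0.
Proof. by apply: expfz_neq0; rewrite oppr_eq0 oner_eq0. Qed.

(** Otherwise [x] would be the only element of [[x, w]] outside the up-set of
    [q], against the vanishing of the alternating sum. *)
Lemma outside_not_isolated x w : ~~ (q <= x) -> j x < w ->
  exists2 z, x < z <= w & ~~ (q <= z).
Proof.
move=> xX jw.
have [/existsP[z /andP[xzw zX]]|] :=
    boolP [exists z, (x < z <= w) && ~~ (q <= z)]; first by exists z.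
rewrite negb_exists => /forallP none.
have := sum_outside_below xX (ltW jw); rewrite lt_eqF // (big_pred1 x).
  by move/eqP; rewrite (negPf (sgn_neq0 x)).
move=> z; have := none z; rewrite /= lt_neqAle.
have [<- _|ne] := eqVneq x z; first by rewrite xX lexx (le_trans (le_pjoin x) (ltW jw)).
by rewrite andbC => /negPf.
Qed.

(** An element strictly between [x] and [y] is above [q], hence above the join of
    [x] and [q]; a join strictly below [y] would leave room for a larger element
    of the fiber, by [outside_not_isolated]. *)
Lemma fiber_le_max x y : q < y -> x \in fiber_le q y ->
  (forall z, z \in fiber_le q y -> ~~ (x < z)) -> rho y = rho x + 1.
Proof.
move=> qy; rewrite (mem_fiber_le _ (ltW qy)) => /andP[xX xy] xmax.
have jy : j x <= y by rewrite pjoin_le xy ltW.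
apply: rkP; rewrite /covers (lt_le_trans (outside_lt_pjoin xX) jy) /=.
apply/forallP => z; apply/negP => /andP[xz zy].
have [qz|zX] := boolP (q <= z); last first.
  by have := xmax z; rewrite (mem_fiber_le _ (ltW qy)) zX ltW // xz => /(_ isT).
have [|w /andP[xw wy] wX] := @outside_not_isolated x y xX.
  by apply: le_lt_trans zy; rewrite pjoin_le ltW.
by have := xmax w; rewrite (mem_fiber_le _ (ltW qy)) wX wy xw => /(_ isT).
Qed.

(** The element [x] is covered by its join with [q], and this join is covered by
    [y]: anything in between would yield a larger element of the fiber. *)
Lemma fiber_lt_max x y : x \in fiber_lt q y ->
  (forall z, z \in fiber_lt q y -> ~~ (x < z)) -> rho y = rho x + 1 + 1.
Proof.
rewrite mem_fiber_lt => /andP[xX jy] xmax.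
have none z w : x < z -> z <= w -> ~~ (q <= z) -> q <= w -> w < y -> False.
  move=> xz zw zX qw wy; have := xmax z; rewrite mem_fiber_lt zX xz /=.
  by rewrite (le_lt_trans _ wy) ?pjoin_le ?zw // => /(_ isT).
have -> : rho x + 1 = rho (j x).
  apply/esym/rkP; rewrite /covers outside_lt_pjoin //; apply/forallP => z.
  apply/negP => /andP[xz zj]; have [qz|zX] := boolP (q <= z).
    by move/lt_geF: zj; rewrite pjoin_le qz ltW.
  exact: none xz (ltW zj) zX (q_le_pjoin x) jy.
apply: rkP; rewrite /covers jy; apply/forallP => w; apply/negP => /andP[jw wy].
have [z /andP[xz zw] zX] := outside_not_isolated xX jw.
by apply: none xz zw zX _ wy; apply: le_trans (q_le_pjoin x) (ltW jw).
Qed.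

Lemma zero_outside : ~~ (q <= zero).
Proof.
by apply: contra q_zero => qz; apply/eqP/le_anti; rewrite qz zero_le.
Qed.

Lemma pjoin_zero : j zero = q.
Proof. by apply/le_anti; rewrite pjoin_le zero_le lexx q_le_pjoin. Qed.

Lemma capped_fiber_lt y : q < y -> capped rho zero (fiber_lt q y) (rho y - 1).
Proof.
move=> qy; split.
- move=> x z; rewrite !mem_fiber_lt => /andP[xX jx] zx.
  rewrite (contra _ xX) /= => [|qz]; last exact: le_trans zx.
  by apply: le_lt_trans jx; apply: pjoin_mono.
- by rewrite mem_fiber_lt zero_outside pjoin_zero.
- by move=> x xF xmax; rewrite (fiber_lt_max xF xmax) addrK.
- move=> x; rewrite mem_fiber_lt => /andP[xX jx].
  by rewrite sum_fiber_lt // signz_pred opprK.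
Qed.

Lemma fiber_le_bottom : fiber_le q q = [set x | x < q].
Proof.
apply/setP => x; rewrite mem_fiber_le // inE lt_neqAle.
case: (boolP (x <= q)) => xq; last by rewrite !andbF.
by rewrite !andbT eq_le xq.
Qed.

Lemma capped_fiber_bottom : capped rho zero (fiber_le q q) (rho q).
Proof.
rewrite fiber_le_bottom; split.
- by move=> x y; rewrite !inE => xq /le_lt_trans; apply.
- by rewrite inE lt_neqAle eq_sym q_zero zero_le.
- move=> x; rewrite inE => xq xmax; apply: rkP; rewrite /covers xq.
  apply/forallP => z; apply/negP => /andP[xz zq].
  by have := xmax z; rewrite inE zq xz => /(_ isT).
- move=> x; rewrite inE => xq; have := euler xq.
  rewrite (bigD1 q) ?lexx ?ltW //= => /eqP; rewrite addrC addr_eq0 => /eqP <-.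
  apply: eq_bigl => z; rewrite inE lt_neqAle.
  by case: (z == q); case: (x <= z); case: (z <= q).
Qed.

(** The semisuspension of the lower fiber over [y]: an element [x] is sent to the
    pair of [x] and the truth value of [j x = y]; in the product order the pair
    [(y, false)] is then above exactly the elements with [j x < y]. *)
Section Semisuspension.
Variable y : T.
Hypothesis qy : q < y.

Let U := subposet (fiber_le q y).
Let k := rho y.

Definition peak_set : {set T *p bool} :=
  [set p | (p.1 == y) || ((p.1 \in fiber_le q y) && (p.2 == (pjoin p.1 q == y)))].

Let S := subposet peak_set.

Fact peak_mem b : (y, b) \in peak_set. Proof. by rewrite inE eqxx. Qed.

Definition peak : S := Sub (y, false) (peak_mem false).
Definition peak_top : S := Sub (y, true) (peak_mem true).

Fact fiber_mem (u : U) : (val u, pjoin (val u) q == y) \in peak_set.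
Proof. by rewrite inE /= (valP u) eqxx orbT. Qed.

Definition fiber_incl (u : U) : S := Sub (val u, pjoin (val u) q == y) (fiber_mem u).

Let f := fiber_incl.

Let uX (u : U) : ~~ (q <= val u).
Proof. by have := valP u; rewrite (mem_fiber_le _ (ltW qy)) => /andP[]. Qed.

Let uy (u : U) : val u <= y.
Proof. by have := valP u; rewrite (mem_fiber_le _ (ltW qy)) => /andP[]. Qed.

Let juy (u : U) : j (val u) <= y.
Proof. by rewrite pjoin_le uy ltW. Qed.

Let y_le (u : U) : (y <= val u) = false.
Proof. by apply: contraNF (uX u) => yu; apply: le_trans (ltW qy) yu. Qed.

Let leS (s t : S) : (s <= t) = ((val s).1 <= (val t).1) && ((val s).2 <= (val t).2).
Proof. by rewrite leEsub leEprod. Qed.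

Let f_mono : {mono f : u v / u <= v}.
Proof.
move=> u v; rewrite leS /= leEsub; case: (boolP (val u <= val v)) => //= uv.
rewrite leEbool; case: (j (val u) =P y) => //= E.
by rewrite eq_le juy (le_trans _ (pjoin_mono uv)) // E.
Qed.

Let le_top (s : S) : s <= peak_top.
Proof.
have := valP s; rewrite leS /= inE leEbool leq_b1 andbT.
case/orP=> [/eqP -> //|/andP[]].
by rewrite (mem_fiber_le _ (ltW qy)) => /andP[].
Qed.

Let f_le_peak (u : U) : (f u <= peak) = (val u \in fiber_lt q y).
Proof.
rewrite leS /= uy mem_fiber_lt uX lt_neqAle juy andbT.
by rewrite leEbool; case: (_ == _).
Qed.

Let peak_neq_top : peak != peak_top.
Proof. by apply/eqP => /(congr1 val)[]. Qed.

Let f_im : f @: [set: U] = [set: S] :\: [set peak; peak_top].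
Proof.
apply/setP => s; rewrite !inE andbT negb_or; apply/imsetP/andP => [[u _ ->]|[s1 s2]].
  have neq b : val (f u) != (y, b).
    apply: contraFneq (y_le u) => -[E _].
    by rewrite le_eqVlt; apply/orP; left; apply/eqP/esym.
  by split; rewrite -val_eqE; apply: neq.
have := valP s; rewrite inE => /orP[/eqP E|/andP[sF /eqP sj]].
  case Eb: (val s).2; [case/eqP: s2 | case/eqP: s1]; apply/val_inj.
    by rewrite [LHS]surjective_pairing E Eb.
  by rewrite [LHS]surjective_pairing E Eb.
exists (Sub (val s).1 sF) => //; apply/val_inj => /=.
by rewrite [LHS]surjective_pairing sj.
Qed.

Let peak_max (s : S) : s != peak_top -> ~~ (peak < s).
Proof.
move=> s1; apply/negP => lt; have := semisusp_cases f_im s.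
case=> [E|E|[u E]]; first by rewrite E ltxx in lt.
  by rewrite E eqxx in s1.
by move/ltW: lt; rewrite E leS /= y_le.
Qed.

Let g : U -> T := val.

Let g_mono : {mono g : x y / x <= y}.
Proof. by move=> u v; rewrite /g leEsub. Qed.

Let g_low u w : w <= g u -> exists v, g v = w.
Proof.
move=> wu; suff wF : w \in fiber_le q y by exists (Sub w wF); rewrite /g SubK.
rewrite (mem_fiber_le _ (ltW qy)) (le_trans wu (uy u)) andbT.
by apply: contra (uX u) => /le_trans; apply.
Qed.

Let zeroF : zero \in fiber_le q y.
Proof. by rewrite (mem_fiber_le _ (ltW qy)) zero_outside zero_le. Qed.

Let u0 : U := Sub zero zeroF.

Let g0 : g u0 = zero. Proof. by rewrite /g SubK. Qed.

Let g_im : g @: [set: U] = fiber_le q y.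
Proof.
apply/setP => w; apply/imsetP/idP => [[u _ ->]|wF]; first exact: valP.
by exists (Sub w wF); rewrite // /g SubK.
Qed.

Let u0_le u : u0 <= u. Proof. by rewrite -g_mono g0. Qed.

Let g_max u : (forall v, ~~ (u < v)) -> k = rho (g u) + 1.
Proof.
move=> umax; apply: (fiber_le_max qy (valP u)) => z zF.
by have := umax (Sub z zF); rewrite -(leW_mono g_mono) /g SubK.
Qed.

Let V : {set U} := [set u | val u \in fiber_lt q y].

Let g_V : g @: V = fiber_lt q y.
Proof.
apply/setP => w; apply/imsetP/idP => [[u]|wF]; first by rewrite inE => uF ->.
have wF' : w \in fiber_le q y.
  by move: wF; rewrite !inE => /andP[-> /ltW].
by exists (Sub w wF'); [rewrite in_set SubK | rewrite /g SubK].
Qed.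

Let peak_eulerian : eulerian S.
Proof.
have capV := capped_fiber_lt qy; case: capV => _ zV maxV sumV.
have gV u : (u \in V) = (g u \in fiber_lt q y) by rewrite inE.
apply: (semisusp_eulerian rkP euler g_mono g_low u0_le g_max f_mono f_im
  peak_neq_top le_top peak_max (V := V)).
- by move=> u; rewrite f_le_peak gV.
- by rewrite gV g0.
- move=> u uV umax; apply: maxV; first by rewrite -gV.
  move=> z; rewrite -g_V => /imsetP[v vV ->].
  by rewrite (leW_mono g_mono); apply: umax.
- move=> u uV; rewrite -(sumV (g u)) -?gV // [RHS](sum_embedding g_mono).
    by apply: eq_bigl => v; rewrite g_mono gV.
  by move=> w /andP[]; rewrite -g_V => /imsetP[v _ ->]; exists v.
- move=> u; have := sum_outside_below (uX u) (juy u).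
  rewrite (sum_embedding g_mono) => [E|w /and3P[wX _ wy]]; last first.
    have wF : w \in fiber_le q y by rewrite (mem_fiber_le _ (ltW qy)) wX.
    by exists (Sub w wF); rewrite /g SubK.
  transitivity (if j (val u) == y then - sgn y else 0).
    by rewrite -E; apply: eq_bigl => v; rewrite uX g_mono uy andbT.
  by rewrite gV mem_fiber_lt uX lt_neqAle juy andbT; case: eqP.
Qed.

Lemma fiber_semisuspension : is_semisuspension U peak.
Proof.
split.
- exact: peak_eulerian.
- have [r eulr _] := semisusp_normalize rkP g_mono g_low u0_le f_mono f_im le_top
    peak_max (etrans (congr1 rho g0) rho0) peak_eulerian.
  exact: eulerian_poset_rank_gt0 eulr (f_lt_one f_im le_top u0).
- exists peak_top; split; last by exists f; split; [exact: f_mono | exact: f_im].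
  + exact: le_unique_maximal.
  + exact: peak_neq_top.
  + exact: peak_max.
Qed.

Lemma boundary_fiber : g @: boundary U = fiber_lt q y.
Proof.
suff -> : boundary U = V by exact: g_V.
apply/setP => u.
have rho0' : rho (g u0) = 0 by rewrite g0.
have [r eulr rE] := semisusp_normalize rkP g_mono g_low u0_le f_mono f_im le_top
    peak_max rho0' peak_eulerian.
rewrite (boundary_semisusp rkP g_mono g_max f_mono f_im peak_neq_top le_top
  peak_max rho0' eulr rE) f_le_peak.
by apply/esym; rewrite inE.
Qed.

Local Notation cone := (cone var_a var_b rho zero).

Lemma local_cd_index_fiber :
  cd_subst (local_cd_index U) =
  cone (fiber_le q y) k + cone (fiber_lt q y) (k - 1) * var_b
  - cone (fiber_lt q y) (k - 1) * (var_a + var_b).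
Proof.
have zle x : g u0 <= x by rewrite g0.
have r0 : rho (g u0) = 0 by rewrite g0.
have ex : exists (dS : Order.disp_t) (S : finPOrderType dS) (hz : S),
    is_semisuspension U hz.
  by exists _, S, peak; apply: fiber_semisuspension.
have cap : capped rho (g u0) (g @: boundary U) (k - 1).
  by rewrite boundary_fiber g0; apply: capped_fiber_lt.
have := cd_subst_local_cd_index rkP euler g_mono g_low zle r0 g_max ex cap.
by rewrite boundary_fiber g_im g0.
Qed.

End Semisuspension.
End Join.

(** * The identity *)

Section Identity.
Context (R : nzRingType) (a b : R).
Let e := a - b.
Context (d : Order.disp_t) (T : finPOrderType d) (rho : T -> int).
Hypothesis rkP : is_rank_function rho.
Variables (zero one q : T).
Hypotheses (zero_le : forall x, zero <= x) (le_one : forall x, x <= one)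
  (q_zero : q != zero) (q_one : q < one) (q_join : join_admissible q).
Implicit Types (x y z w : T).

Local Notation j x := (pjoin x q).
Local Notation K := (cone_weight a b rho zero).
Local Notation gap := (gap rho).
Local Notation psi := (psi a b rho).
Local Notation epow := (epow a b rho).
Local Notation cone := (cone a b rho zero).

(** The part of [psi zero y] that comes from the chains avoiding the up-set of
    [q], apart from [y] itself. *)
Let Gc y := cone (fiber_le q y) (rho y).
(** The ab-index of the boundary of the fiber over [y], completed by a top. *)
Let Bc y := cone (fiber_lt q y) (rho y - 1).

(** Chains sorted by their first element above [q]. *)
Lemma psi_first_above y : q <= y ->
  psi zero y = Gc y + \sum_(w | q <= w < y) Gc w * b * psi w y.
Proof.
move: {2}_.+1 (ltnSn #|[set w | w < y]|) => n; elim: n y => // n IH y lt_n qy.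
have y0 : zero < y.
  by apply: lt_le_trans qy; rewrite lt_neqAle eq_sym q_zero zero_le.
have step w : q <= w < y -> psi zero w = Gc w + \sum_(v | q <= v < w) Gc v * b * psi v w.
  case/andP => qw wy; apply: IH qw; rewrite -ltnS; apply: leq_trans lt_n; rewrite ltnS.
  apply: proper_card; apply/properP; split.
    by apply/subsetP => v; rewrite !inE => /lt_trans; apply.
  by exists w; [rewrite inE | rewrite inE ltxx].
rewrite (psi_cone a b rkP zero_le y0) /cone (bigID (fun x => q <= x)) /= addrC.
congr (_ + _).
  apply: eq_bigl => x; rewrite (mem_fiber_le q_join) // inE lt_neqAle andbC.
  by case: (boolP (q <= x)) => //= qx; case: eqP => //= E; rewrite E qy in qx.
rewrite (eq_big (fun w => q <= w < y)
  (fun w => Gc w * b * epow w y +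
     \sum_(v | q <= v < w) Gc v * b * psi v w * b * epow w y)).
- rewrite big_split /= (exchange_big_dep (fun v => q <= v < y)) /=; last first.
    by move=> w v /andP[_ wy] /andP[-> vw]; apply: lt_trans wy.
  rewrite -big_split /=; apply: eq_bigr => v /andP[qv vy].
  rewrite (psi_recr a b rkP vy) mulrDr mulr_sumr; congr (_ + _).
  apply: eq_big => [w|w _]; last by rewrite !mulrA.
  case: (boolP (v < w)) => vw; last by rewrite !andbF.
  by rewrite qv (le_trans qv (ltW vw)) !andbT.
- by move=> w; rewrite inE andbC.
move=> w; rewrite inE andbC => qwy; case/andP: (qwy) => qw wy.
rewrite /cone_weight gt_eqF; last first.
  by rewrite (lt_le_trans _ qw) // lt_neqAle eq_sym q_zero zero_le.
by rewrite step // !mulrDl !mulr_suml.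
Qed.

Lemma coneG y : q <= y ->
  Gc y = \sum_(x | ~~ (q <= x) && (x <= y)) K x * epow x y.
Proof. by move=> qy; apply: eq_bigl => x; apply: mem_fiber_le. Qed.

(** The factor [e] raises all exponents by one, so that the cone of rank
    [rho y - 1] is measured from [y] itself. *)
Lemma coneB y : Bc y * e = \sum_(x | ~~ (q <= x) && (j x < y)) K x * epow x y.
Proof.
rewrite mulr_suml; apply: eq_big => [x|x]; first by rewrite mem_fiber_lt.
rewrite mem_fiber_lt => /andP[xX jy]; rewrite -mulrA; congr (_ * _).
rewrite -exprSr; congr (_ ^+ _).
have := rank_lt rkP jy; have := rank_lt rkP (outside_lt_pjoin q_join xX).
by rewrite /gap; lia.
Qed.

Lemma epow_split x w y : x < w -> w < y -> epow x y = epow x w * e * epow w y.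
Proof. by move=> xw wy; rewrite /epow -/e (gapD rkP xw wy) -exprSr -exprD addnS. Qed.

(** Both sides are sums over [x] outside the up-set of [q]; the coefficient of
    the weight of [x] is, up to a power of [e] on the left, the recursion of
    [psi] on the interval from the join of [x] and [q]. *)
Lemma cone_exchange :
  Bc one * e + \sum_(y | q < y < one) Bc y * e * a * psi y one =
  \sum_(y | q <= y < one) Gc y * e * psi y one.
Proof.
rewrite coneB [X in _ + X = _](eq_bigr (fun y => \sum_(x | ~~ (q <= x) && (j x < y))
  K x * (epow x y * a * psi y one))) => [|y _]; last first.
  by rewrite coneB !mulr_suml; apply: eq_bigr => x _; rewrite !mulrA.
rewrite [RHS](eq_bigr (fun y => \sum_(x | ~~ (q <= x) && (x <= y))
  K x * (epow x y * e * psi y one))) => [|y /andP[qy _]]; last first.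
  by rewrite coneG // !mulr_suml; apply: eq_bigr => x _; rewrite !mulrA.
rewrite (exchange_big_dep (fun x => ~~ (q <= x) && (j x < one))) /=; last first.
  by move=> y x /andP[_ y1] /andP[-> jy]; apply: lt_trans y1.
rewrite [RHS](exchange_big_dep (fun x => ~~ (q <= x) && (j x < one))) /=; last first.
  move=> y x /andP[qy y1] /andP[-> xy] /=; apply: le_lt_trans y1.
  by rewrite (pjoin_le q_join) xy.
rewrite -big_split /=; apply: eq_bigr => x /andP[xX j1].
rewrite -!mulr_sumr -mulrDr; congr (_ * _).
have xj := outside_lt_pjoin q_join xX.
rewrite (eq_bigl (fun y => j x < y < one)) => [|y]; last first.
  rewrite xX /=; case: (boolP (j x < y)) => jy; last by rewrite andbF.
  by rewrite (le_lt_trans (q_le_pjoin q_join x) jy) andbT.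
rewrite [RHS](eq_bigl (fun y => j x <= y < one)) => [|y]; last first.
  by rewrite xX (pjoin_le q_join); case: (x <= y); case: (q <= y); case: (y < one).
rewrite [RHS](bigD1 (j x)) ?lexx //=.
rewrite [X in _ = _ + X](eq_bigl (fun y => j x < y < one)); last first.
  move=> y; rewrite (lt_neqAle (j x)) (eq_sym (j x)).
  by case: (y == j x); case: (j x <= y); case: (y < one).
rewrite (epow_split xj j1).
rewrite (eq_bigr (fun y => epow x (j x) * e * (epow (j x) y * a * psi y one)));
    last first.
  by move=> y /andP[jy _]; rewrite (epow_split xj jy) !mulrA.
rewrite [X in _ = _ + X](eq_bigr (fun y =>
    epow x (j x) * e * (epow (j x) y * e * psi y one))); last first.
  by move=> y /andP[jy _]; rewrite (epow_split xj jy) !mulrA.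
rewrite -!mulr_sumr -!mulrDr; congr (_ * _).
rewrite (psi_convl a b rkP j1) -addrA /conv -big_split /=; congr (_ + _).
by apply: eq_bigr => y _; rewrite -mulrDl -mulrDr [b + e]addrC subrK.
Qed.

(** The local ab-index of the fiber over [y]: chains of the semisuspension, minus
    the boundary term. *)
Let Lc y := Gc y + Bc y * b - Bc y * (a + b).

Lemma LcE y : Lc y = Gc y - Bc y * a.
Proof. by rewrite /Lc mulrDr opprD [- _ - _]addrC addrA addrK. Qed.

Let zmod_rearrange (X P E S Z W U Q : R) :
  E + Q = Z -> U + W = Z + (S + S) ->
  X + S + (X + S) = X - P + (X - P) + (P + P - E + U + (W - Q)).
Proof.
move=> EQ UW; rewrite [RHS](AC ((2*2)*(((2*1)*1)*2))
  ((1*3)*((2*5)*((4*6)*((8*9)*(7*10)))))) /= !addNr !add0r UW.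
by rewrite -opprD EQ [Z + _]addrC addrK addrACA.
Qed.

(** Twice the sum over first elements above [q] differs from the right-hand side
    only by the two members of [cone_exchange]. *)
Lemma psi_decomposition :
  psi zero one + psi zero one =
  Lc one + Lc one +
  (Bc one * (a + b) + Gc q * (a + b) * psi q one +
   \sum_(y | q < y < one)
      (Lc y * (a + b) + Bc y * (a * b + b * a)) * psi y one).
Proof.
rewrite psi_first_above ?ltW //.
have EL y : Lc y * (a + b) + Bc y * (a * b + b * a) = Gc y * (a + b) - Bc y * e * a.
  rewrite LcE mulrBl -addrA; congr (_ + _).
  have Ee : e * a = a * (a + b) - (a * b + b * a).
    by rewrite /e mulrBl mulrDr opprD addrA addrK.
  by rewrite -!(mulrA (Bc y)) Ee mulrBr opprB addrC.
under [X in _ = _ + (_ + X)]eq_bigr do rewrite EL mulrBl.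
rewrite sumrB.
have EB : Bc one * (a + b) = Bc one * a + Bc one * a - Bc one * e.
  by rewrite /e mulrBr mulrDr opprB addrACA subrr addr0.
have EG (F : T -> R) : \sum_(y | q <= y < one) F y = F q + \sum_(y | q < y < one) F y.
  rewrite (bigD1 q) ?lexx //=; congr (_ + _); apply: eq_bigl => y.
  by rewrite (lt_neqAle q) (eq_sym q); case: (y == q); case: (q <= y); case: (y < one).
have Eab y : Gc y * (a + b) * psi y one - Gc y * e * psi y one =
    Gc y * b * psi y one + Gc y * b * psi y one.
  rewrite -mulrBl -mulrDl -mulrBr -mulrDr; congr (_ * _ * _).
  by rewrite /e opprB [b - a]addrC addrACA subrr add0r.
rewrite EB !LcE; apply: zmod_rearrange cone_exchange _.
rewrite -(EG (fun y => Gc y * (a + b) * psi y one)) -!big_split /=.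
by apply: eq_bigr => y _; rewrite -Eab addrC subrK.
Qed.

End Identity.

Section Transfer.
Context (S R : lalgType rat) (phi : {lrmorphism S -> R}) (c' d' : S) (a b : R).
Hypotheses (phi_inj : injective phi) (phi_c : phi c' = a + b)
  (phi_d : phi d' = a * b + b * a).

(** An injective morphism reflects the identity, and 2 is invertible. *)
Lemma transfer_identity (I : finType) (P : pred I) (x l p s t : S)
    (ls ps ts : I -> S) (px pl pp ps' pt : R) (fl fp ft : I -> R) :
    phi x = px -> phi l = pl -> phi p = pp -> phi s = ps' -> phi t = pt ->
    (forall i, P i -> phi (ls i) = fl i) ->
    (forall i, P i -> phi (ps i) = fp i) ->
    (forall i, P i -> phi (ts i) = ft i) ->
    px + px = pl + pl + (pp * (a + b) + ps' * (a + b) * pt +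
      \sum_(i | P i) (fl i * (a + b) + fp i * (a * b + b * a)) * ft i) ->
  x = l + (2%:R^-1 : rat) *:
    (p * c' + s * c' * t + \sum_(i | P i) (ls i * c' + ps i * d') * ts i).
Proof.
move=> Ex El Ep Es Et Els Eps Ets E; apply: phi_inj.
have two : phi x + phi x = (2%:R : rat) *: phi x by rewrite scaler_nat mulr2n.
have cancel2 (u : R) : (2%:R^-1 : rat) *: ((2%:R : rat) *: u) = u.
  by rewrite scalerA mulVf ?scale1r // pnatr_eq0.
rewrite raddfD /= linearZ /= -[LHS]cancel2 -two Ex E scalerDr El; congr (_ + _).
  by rewrite -mulr2n -scaler_nat cancel2.
congr (_ *: _); rewrite !raddfD /= raddf_sum /= !rmorphM /= phi_c Ep Es Et.
congr (_ + _); apply: eq_bigr => i Pi.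
by rewrite rmorphM raddfD /= !rmorphM /= phi_c phi_d Els ?Eps ?Ets.
Qed.

End Transfer.

Local Close Scope order_scope.
Unset Implicit Arguments.

Theorem proposition1p3 (d : Order.disp_t) (G : finPOrderType d)
    (zero one q : G)
    (hG : eulerian G) (hcard : (1 < #|G|)%N)
    (hzero : unique (@is_minimal d G) zero)
    (hone : unique (@is_maximal d G) one)
    (hq0 : q <> zero) (hq1 : q <> one) (hq : join_admissible q) :
  cd_index G =
    local_cd_index (subposet (outside_of q))
    + (2%:R^-1 : rat) *:
      ( cd_index (with_top (subposet (fiber_lt q one))) * var_c
      + cd_index (with_top (subposet (fiber_le q q))) * var_c
          * cd_index (subposet (upset_of q))
      + \sum_(y : G | (q < y < one)%O)
          ( local_cd_index (subposet (fiber_le q y)) * var_c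
          + cd_index (with_top (subposet (fiber_lt q y))) * var_d )
          * cd_index (subposet (cinterval y one)) ).
Proof.
have [rk [zero' [one' eul]]] := hG.
have zle := unique_minimal_le hzero; have ole := unique_maximal_le hone.
pose rho x := rk x - rk zero.
have rho0 : rho zero = 0 by apply: subrr.
have [rkP _ _ euler] : eulerian_with rho zero' one' by apply: eulerian_shift.
have eulG : eulerian_with rho zero one by split.
have q_zero : q != zero by apply/eqP.
have q_one : (q < one)%O by rewrite lt_neqAle ole andbT; apply/eqP.
have zero_one : (zero < one)%O by apply: le_lt_trans q_one.
have -> : outside_of q = fiber_le q one.
  by apply/setP => x; rewrite (mem_fiber_le hq _ (ltW q_one)) ole andbT !inE.
have -> : upset_of q = cinterval q one.
  by apply/setP => x; rewrite !inE ole andbT.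
have val_mono (A : {set G}) : {mono (val : subposet A -> G) : u v / (u <= v)%O}.
  by move=> u v; rewrite leEsub.
have val_im (A : {set G}) : (val : subposet A -> G) @: [set: subposet A] = A.
  apply/setP => w; apply/imsetP/idP => [[u _ ->]|wA]; first exact: valP.
  by exists (Sub w wA); rewrite // SubK.
have top_lt y : (q < y)%O -> cd_subst (cd_index (with_top (subposet (fiber_lt q y)))) =
    cone var_a var_b rho zero (fiber_lt q y) (rho y - 1).
  move=> qy; apply: (with_top_cone rkP zle euler (val_mono _) (val_im _)).
  exact: capped_fiber_lt.
apply: (transfer_identity cd_subst_inj cd_subst_c cd_subst_d
  (cd_subst_cd_index eulG zero_one)
  (local_cd_index_fiber rkP euler zle rho0 q_zero hq q_one)
  (top_lt _ q_one)
  (with_top_cone rkP zle euler (val_mono _) (val_im _)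
     (capped_fiber_bottom rkP euler zle q_zero hq))
  (cd_index_interval rkP euler q_one)
  (fun y qy1 => local_cd_index_fiber rkP euler zle rho0 q_zero hq (proj1 (andP qy1)))
  (fun y qy1 => top_lt y (proj1 (andP qy1)))
  (fun y qy1 => cd_index_interval rkP euler (proj2 (andP qy1)))).
exact: psi_decomposition.
Qed.
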